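(* Let $\alpha\in(1,2]$ and $1/\alpha+1/\beta=1$. There exist $A,B>0$ such that for every smooth function $f$ on $\mathbb{R}$ with $f\ge0$ and $\int f^2d\mu_\alpha=1$, $$\mathbf{Ent}_{\mu_\alpha}(f^2)\le A\,\mathbf{Var}_{\mu_\alpha}(f)+B\int_{\{f\ge2\}}\Big|\frac{f'}{f}\Big|^\beta f^2d\mu_\alpha .$$ In the extreme case $\alpha=1$, there exists $A>0$ such that for every smooth enough function $f$ on $\mathbb{R}$ with $f\ge0$, $\int f^2d\mu_1=1$ and $|f'|\le1$, $$\mathbf{Ent}_{\mu_1}(f^2)\le A\,\mathbf{Var}_{\mu_1}(f).$$
   Context: For $\alpha\ge1$, $\mu_\alpha$ is the probability measure on $\mathbb{R}$ given by $\mu_\alpha(dx)=\frac1{Z_\alpha}e^{-|x|^\alpha}dx$, $Z_\alpha=\int e^{-|x|^\alpha}dx$. For a probability measure $\mu$, $\mathbf{Ent}_{\mu}(f^2)=\int f^2\log\frac{f^2}{\int f^2d\mu}d\mu$ and $\mathbf{Var}_{\mu}(f)=\int f^2d\mu-\big(\int f d\mu\big)^2$. *)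

(* Defs.v *)
From HB Require Import structures.
From mathcomp Require Import all_boot all_order all_algebra.
From mathcomp Require Import all_classical all_reals all_analysis.
From mathcomp Require Import measurable_realfun.

Set Implicit Arguments.
Unset Strict Implicit.
Unset Printing Implicit Defensive.

Import Order.TTheory GRing.Theory Num.Theory.
Import numFieldNormedType.Exports.

Local Open Scope classical_set_scope.
Local Open Scope ring_scope.

Section mu_alpha.
Context {R : realType}.
Local Notation leb := (@lebesgue_measure R).

Definition expabs (a x : R) : R := expR (- (`|x| `^ a)).

Definition Zalpha (a : R) : R := (\int[leb]_x expabs a x)%R.

(* The proof of [1 <= a] is an argument so that the probability structure can
   be attached to [mu_alpha a1] below. *)
Definition mu_alpha (a : R) (a1 : 1 <= a) : set R -> \bar R :=
  fun V => (\int[leb]_(x in V) ((Zalpha a)^-1 * expabs a x)%:E)%E.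

Lemma expabs_ge0 (a x : R) : 0 <= expabs a x.
Proof. exact: expR_ge0. Qed.

Lemma measurable_expabs (a : R) : measurable_fun [set: R] (expabs a).
Proof.
apply: measurableT_comp => //; apply: measurableT_comp => //.
by apply: (measurableT_comp (measurable_powR a)) => //; exact: normr_measurable.
Qed.

Lemma integral_expabs1 : (\int[leb]_x (expabs 1 x)%:E = 2%:E)%E.
Proof.
rewrite ge0_symfun_integralT /=; last 3 first.
- by move=> x; exact: expabs_ge0.
- move=> x; rewrite /expabs.
  under [X in continuous_at _ X]eq_fun do rewrite powRr1//.
  apply: continuous_comp; last exact: continuous_expR.
  by apply: (@continuousN _ R^o); exact: norm_continuous.
- by move=> x; rewrite /expabs /= normrN.
rewrite -[RHS]mule1 -(@integral_exponential_pdf R 1)//; congr (_ * _)%E.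
rewrite integral_mkcond; apply: eq_integral => x _ /=.
rewrite /exponential_pdf !patchE set_itvcy.
case: ifPn => //; rewrite inE/= => x0.
by rewrite /expabs powRr1// ger0_norm// mul1r mulN1r.
Qed.

Lemma expabs_le (a x : R) : 1 <= a -> expabs a x <= expR 1 * expabs 1 x.
Proof.
move=> a1; rewrite /expabs -expRD ler_expR powRr1// lerNl opprD opprK.
have [x1|x1] := leP `|x| 1.
  rewrite (@le_trans _ _ 0) ?powR_ge0// addrC subr_le0.
  by [].
rewrite (@le_trans _ _ `|x|)//; first by rewrite addrC gerBl.
by rewrite -{1}(powRr1 (normr_ge0 x)) ler_powR// ltW.
Qed.

Lemma integral_expabs_lty (a : R) : 1 <= a ->
  (\int[leb]_x (expabs a x)%:E < +oo)%E.
Proof.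
move=> a1; apply: (@le_lt_trans _ _
    (\int[leb]_x ((expR 1)%:E * (expabs 1 x)%:E))%E).
  apply: ge0_le_integral => //.
  - by move=> x _; rewrite lee_fin expabs_ge0.
  - by apply/measurable_EFinP; exact: measurable_expabs.
  - apply/measurable_EFinP; apply: measurable_funM => //.
    exact: measurable_expabs.
  - by move=> x _; rewrite -EFinM lee_fin expabs_le.
rewrite ge0_integralZl//.
- by rewrite integral_expabs1 -EFinM ltry.
- by apply/measurable_EFinP; exact: measurable_expabs.
- by move=> x _; rewrite lee_fin expabs_ge0.
Qed.

Lemma EFin_Zalpha (a : R) : 1 <= a ->
  (Zalpha a)%:E = (\int[leb]_x (expabs a x)%:E)%E.
Proof.
move=> a1; rewrite /Zalpha /Rintegral fineK// ge0_fin_numE.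
  exact: integral_expabs_lty.
by apply: integral_ge0 => x _; rewrite lee_fin expabs_ge0.
Qed.

Lemma Zalpha_gt0 (a : R) : 1 <= a -> 0 < Zalpha a.
Proof.
move=> a1; rewrite -lte_fin EFin_Zalpha//.
have mE : measurable_fun [set: R] (EFin \o expabs a).
  by apply/measurable_EFinP; exact: measurable_expabs.
apply: (@lt_le_trans _ _ (\int[leb]_(x in `[0%R, 1%R]) (expabs a x)%:E)%E);
  last first.
  by apply: ge0_subset_integral => // x _; rewrite lee_fin expabs_ge0.
apply: (@lt_le_trans _ _ (\int[leb]_(x in `[0%R, 1%R]) (expR (-1))%:E)%E).
  rewrite integral_cst//= lebesgue_measure_itv/= lte_fin ltr01 oppr0 addr0 mule1.
  by rewrite lte_fin expR_gt0.
apply: ge0_le_integral => //.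
- exact: measurable_funTS.
- move=> x; rewrite /= in_itv/= => /andP[x0 x1].
  rewrite lee_fin ler_expR lerN2 ger0_norm//.
  rewrite -[leRHS](_ : 1 `^ a = 1); last by rewrite powR1.
  by rewrite ge0_ler_powR ?nnegrE ?(le_trans _ a1).
Qed.

End mu_alpha.

Section mu_alpha_probability.
Context {R : realType}.
Local Notation leb := (@lebesgue_measure R).
Variables (a : R) (a1 : 1 <= a).

Let density_ge0 x : 0 <= (Zalpha a)^-1 * expabs a x.
Proof. by rewrite mulr_ge0 ?expabs_ge0// invr_ge0 ltW ?Zalpha_gt0. Qed.

Let mu0 : mu_alpha a1 set0 = 0%E.
Proof. by rewrite /mu_alpha integral_set0. Qed.

Let mu_ge0 A : (0 <= mu_alpha a1 A)%E.
Proof. by apply: integral_ge0 => x _; rewrite lee_fin. Qed.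

Let mu_sigma_additive : semi_sigma_additive (mu_alpha a1).
Proof.
move=> /= F mF tF mUF; rewrite /mu_alpha; apply: cvg_toP.
  apply: ereal_nondecreasing_is_cvgn => m n mn.
  apply: lee_sum_nneg_natr => // k _ _; apply: integral_ge0 => /= x _.
  by rewrite lee_fin.
rewrite ge0_integral_bigcup//=.
- apply/measurable_funTS/measurable_EFinP; apply: measurable_funM => //.
  exact: measurable_expabs.
- by move=> x _; rewrite lee_fin.
Qed.

HB.instance Definition _ := isMeasure.Build _ _ _
  (mu_alpha a1) mu0 mu_ge0 mu_sigma_additive.

Let mu_setT : mu_alpha a1 [set: R] = 1%E.
Proof.
rewrite /mu_alpha.
under eq_integral do rewrite EFinM.
rewrite ge0_integralZl//.
- by rewrite -EFin_Zalpha// -EFinM mulVf// gt_eqF// Zalpha_gt0.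
- by apply/measurable_EFinP; exact: measurable_expabs.
- by move=> x _; rewrite lee_fin expabs_ge0.
- by rewrite lee_fin invr_ge0 ltW// Zalpha_gt0.
Qed.

HB.instance Definition _ :=
  @Measure_isProbability.Build _ _ R (mu_alpha a1) mu_setT.

End mu_alpha_probability.

(* [ln 0 = 0] in the library, which gives the usual convention 0 log 0 = 0.
   The value is extended real: the negative part of t log t is bounded, so for
   g >= 0 of finite nonzero mean it is well defined and possibly +oo. *)
Definition Ent d (T : measurableType d) (R : realType) (P : probability T R)
    (g : T -> R) : \bar R :=
  (\int[P]_x (g x * ln (g x / fine (\int[P]_y (g y)%:E)))%:E)%E.

Definition Cinfty (R : realType) (f : R -> R) : Prop :=
  forall n x, derivable (f^`(n))%classic x 1.

Definition C1 (R : realType) (f : R -> R) : Prop :=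
  (forall x, derivable f x 1) /\ continuous (f^`())%classic.

(* Main.v *)
Require Import Defs.
From HB Require Import structures.
From mathcomp Require Import all_boot all_order all_algebra.
From mathcomp Require Import all_classical all_reals all_analysis.
From mathcomp Require Import measurable_realfun ring lra.

(** With [int f^2 = 1], the nonnegative function [f^2 ln f^2 - f^2 + 1] is at
    most [16 (f - 1)^2] where [f < 3], and [int (f - 1)^2 <= 2 Var f]; so only
    [int_{f >= 3} f^2 ln f^2] matters.  Moreover [int_{f >= 2} f^2 <= 8 Var f].

    Case [1 < a].  Let [w] be the integral of [f^2 (1 + |f'/f|^b)] over
    [{f >= 2}].  Since [f < 2] somewhere in a fixed interval [[-T, T]],
    integrating the derivative of [(f - 2)_+^2] from there gives
    [f(x)^2 e^{-|x|^a} <= K w] wherever [f x >= 3], whence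
    [ln f^2 <= |x|^a + K w] there.  It remains to bound
    [int_{f >= 3} f^2 |x|^a] by [w]: integrate the derivative of
    [x e^{-|x|^a} h(f - 2)], where the boundary terms have the right sign, and
    absorb the cross term [x h'(f - 2) f'] by Young's inequality.

    Case [a = 1].  Now [f] is 1-Lipschitz, and the same scheme with the bounded
    multiplier [x / (1 + |x|)] and [h(s) = s_+^3] works directly, because
    [h' <= h / 2] for large [s]. *)

Set Implicit Arguments.
Unset Strict Implicit.
Unset Printing Implicit Defensive.

Import Order.TTheory GRing.Theory Num.Theory.
Import numFieldNormedType.Exports.

Local Open Scope classical_set_scope.
Local Open Scope ring_scope.

(** * Integration against [mu_alpha] as weighted Lebesgue integration *)

Section integral_mu_alpha.
Context {R : realType}.
Local Notation leb := (@lebesgue_measure R).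
Import HBNNSimple.
Local Open Scope ereal_scope.

(** For the indicator of a measurable set this is the definition of [mu_alpha]. Simple functions
    follow by linearity, and monotone convergence along the approximations [f_], on both sides,
    gives the general case. *)
Lemma ge0_integral_mu_alpha (a : R) (a1 : (1 <= a)%R) (g : R -> R) :
  measurable_fun [set: R] g -> (forall x, (0 <= g x)%R) ->
  \int[mu_alpha a1]_x (g x)%:E =
  (Zalpha a)^-1%:E * \int[leb]_x (g x * expabs a x)%:E.
Proof.
move=> mg g0.
have mE : measurable_fun [set: R] (EFin \o expabs a).
  by apply/measurable_EFinP; exact: measurable_expabs.
have mg' : measurable_fun [set: R] (EFin \o g) by apply/measurable_EFinP.
have Z0 : (0 <= (Zalpha a)^-1)%R by rewrite invr_ge0 ltW// Zalpha_gt0.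
pose dens x := ((Zalpha a)^-1 * expabs a x)%R.
have dens0 x : (0 <= dens x)%R by rewrite mulr_ge0// expabs_ge0.
have mdens : measurable_fun [set: R] dens.
  by apply: measurable_funM => //; exact: measurable_expabs.
transitivity (\int[leb]_x (g x * dens x)%:E); last first.
  rewrite -ge0_integralZl//=.
  - by apply: eq_integral => x _; rewrite -EFinM /dens mulrCA.
  - apply/measurable_EFinP; apply: measurable_funM => //.
    exact: measurable_expabs.
  - by move=> x _; rewrite lee_fin mulr_ge0// expabs_ge0.
pose f_ := nnsfun_approx measurableT mg'.
have mf_ n : measurable_fun [set: R] (f_ n) by exact: measurable_funP.
have nd_ x m n : (m <= n)%N -> (f_ m x <= f_ n x)%R.
  by move=> mn; exact/lefP/nd_nnsfun_approx.
transitivity (limn (fun n => \int[mu_alpha a1]_x (f_ n x)%:E)).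
  rewrite -monotone_convergence//.
  - apply: eq_integral => y _; apply/esym/cvg_lim => //.
    by apply: cvg_nnsfun_approx => // x _; rewrite lee_fin.
  - by move=> n; exact/measurable_EFinP/measurable_funP.
  - by move=> n y _; rewrite lee_fin.
  - by move=> y _ m n mn; rewrite lee_fin; exact/lefP/nd_nnsfun_approx.
transitivity (limn (fun n => \int[leb]_x (f_ n x * dens x)%:E)); last first.
  rewrite -monotone_convergence//.
  - apply: eq_integral => y _; apply/cvg_lim => //.
    under eq_fun do rewrite EFinM.
    rewrite EFinM; apply: cvgeZr => //.
    by apply: cvg_nnsfun_approx => // x _; rewrite lee_fin.
  - move=> n; apply/measurable_EFinP; apply: measurable_funM; last exact: mdens.
    exact: mf_.
  - by move=> n y _; rewrite lee_fin mulr_ge0.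
  - move=> y _ m n mn; rewrite lee_fin ler_wpM2r//.
    exact: nd_.
congr (limn _); apply/funext => n.
have m1 r : measurable_fun [set: R]
    (fun x => (r * \1_(f_ n @^-1` [set r]) x)%:E).
  by apply/measurable_EFinP/measurable_funM.
under eq_integral do rewrite fimfunE -fsumEFin//.
rewrite ge0_integral_fsum//; last first.
  by move=> y x _; rewrite nnfun_muleindic_ge0.
transitivity (\int[leb]_x \sum_(r \in range (f_ n))
    ((r * \1_(f_ n @^-1` [set r]) x)%:E * (dens x)%:E)); last first.
  apply: eq_integral => x _; rewrite [in RHS]EFinM fimfunE -fsumEFin//.
  by rewrite ge0_mule_fsuml// => r; exact: nnfun_muleindic_ge0.
rewrite ge0_integral_fsum//; last 2 first.
- by move=> y; apply: emeasurable_funM; [exact: m1|exact/measurable_EFinP].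
- by move=> y x _; rewrite mule_ge0 ?nnfun_muleindic_ge0 ?lee_fin.
apply: eq_fsbigr => r _.
(* The approximations are nonnegative, so a negative [r] has empty preimage and both sides
   vanish. *)
have [r0|r0] := leP 0%R r; last first.
  rewrite !integral0_eq// => x _.
    by rewrite preimage_nnfun0// indic0 mulr0 mul0e.
  by rewrite preimage_nnfun0// indic0 mulr0.
rewrite integralZl_indic_nnsfun// integral_indic//= setIT.
under eq_integral do rewrite (EFinM r) -muleA.
rewrite ge0_integralZl//; last 2 first.
- apply: emeasurable_funM; last exact/measurable_EFinP.
  apply/measurable_EFinP.
  have mA : @measurable _ R (f_ n @^-1` [set r]) by [].
  exact: (measurable_indic mA).
- by move=> x _; rewrite mule_ge0 ?lee_fin.
congr (_ * _); rewrite /mu_alpha [LHS]integral_mkcond/=.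
apply: eq_integral => x _; rewrite patchE indicE.
by case: ifPn => _; rewrite ?mul1e ?mul0e.
Qed.

End integral_mu_alpha.

(** * Derivatives of products with even functions and of powers of the positive part *)

Section calculus.
Context {R : realType}.
Implicit Types (x y : R).

Lemma is_derive1_continuous (f f' : R -> R) :
  (forall x, is_derive x 1 f (f' x)) -> continuous f.
Proof.
by move=> df x; apply: differentiable_continuous; apply/derivable1_diffP.
Qed.

(** The difference quotient at 0 is [k] itself, so continuity of [k] at 0 is enough. *)
Lemma is_derive_mulx_at0 (k : R -> R) :
  {for 0, continuous k} -> is_derive (0 : R) 1 (fun x => x * k x) (k 0).
Proof.
move=> ck.
have cvgk : h^-1 *: (((fun x => x * k x) \o shift 0) (h *: (1:R)) - 0 * k 0)
    @[h --> 0^'] --> k 0.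
  apply: (@cvg_trans _ (k h @[h --> 0^'])).
    apply: near_eq_cvg; near=> h.
    rewrite /= !scaler1 addr0 mul0r subr0 /GRing.scale/= mulKf//.
    by near: h; exact: nbhs_dnbhs_neq.
  by apply: cvg_within_filter; exact: ck.
split; first by apply/cvg_ex; exists (k 0).
by rewrite /derive; apply/cvg_lim.
Unshelve. all: by end_near. Qed.

(** The factor [y] smooths the kink of |y| at 0, which is handled by [is_derive_mulx_at0]; away from
    0 the function agrees locally with one free of absolute values. It serves to differentiate the
    multipliers x e^{-|x|^a} and their bounded variant. *)
Lemma is_derive_mulx_even (k k' : R -> R) x :
  (forall y, 0 < y -> is_derive y 1 k (k' y)) ->
  {for 0, continuous (fun y => k `|y|)} ->
  is_derive x 1 (fun y => y * k `|y|) (k `|x| + `|x| * k' `|x|).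
Proof.
move=> dk ck; have [x0|x0|->] := ltgtP x 0; last first.
- rewrite normr0 mul0r addr0.
  by have := is_derive_mulx_at0 ck; rewrite normr0.
- rewrite gtr0_norm//; apply: (@near_eq_is_derive _ _ _ (fun y => y * k y)).
    by near=> y; rewrite gtr0_norm//; near: y; exact: lt_nbhsr.
  have ? := dk _ x0.
  by apply: is_derive_eq; rewrite /GRing.scale/= mulr1 addrC.
- have Nx0 : 0 < - x by rewrite oppr_gt0.
  rewrite ltr0_norm//.
  apply: (@near_eq_is_derive _ _ _ (fun y => y * (k \o -%R) y)).
    by near=> y; rewrite ltr0_norm//; near: y; exact: lt_nbhsl.
  have ? := dk _ Nx0.
  by apply: is_derive_eq; rewrite /GRing.scale/= mulr1 addrC mulrN1 mulrN mulNr.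
Unshelve. all: by end_near. Qed.

Lemma continuous_pos_part : continuous (fun x => Num.max x 0).
Proof. by move=> x; apply: continuous_max => //; exact: cst_continuous. Qed.

Lemma continuous_pos_partX n : continuous (fun x => Num.max x 0 ^+ n).
Proof.
move=> x; apply: (cvg_comp (fun s => Num.max s 0) (@GRing.exp R ^~ n)).
  exact: continuous_pos_part.
exact: exprn_continuous.
Qed.

Lemma is_derive_pos_partX n x :
  is_derive x 1 (fun s => Num.max s 0 ^+ n.+2)
    (n.+2%:R * Num.max x 0 ^+ n.+1).
Proof.
have [x0|x0|->] := ltgtP x 0; last first.
- rewrite expr0n mulr0.
  (* At 0 one factor [s] is split off, so that [is_derive_mulx_at0] applies. *)
  rewrite [X in is_derive _ _ X _](_ : _ =
      (fun s => s * Num.max s 0 ^+ n.+1)); last first.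
    apply/funext => s; have [s0|s0] := leP s 0.
      by rewrite !expr0n mulr0.
    by rewrite -exprS.
  have := @is_derive_mulx_at0 (fun s => Num.max s 0 ^+ n.+1).
  rewrite maxxx expr0n/=; apply; exact: continuous_pos_partX.
- apply: (@near_eq_is_derive _ _ _ (fun y => y ^+ n.+2)).
    by near=> y; rewrite max_l// ltW//; near: y; exact: lt_nbhsr.
  have := is_deriveX n.+2 (is_derive_id x 1).
  by rewrite exprfctE /GRing.scale/= mulr1.
- rewrite expr0n mulr0; apply: (@near_eq_is_derive _ _ _ (cst 0)).
    by near=> y; rewrite max_r ?expr0n// ltW//; near: y; exact: lt_nbhsl.
Unshelve. all: by end_near. Qed.

End calculus.

(** * Integral comparison from a differential inequality *)

Section ftc_comparison.
Context {R : realType}.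
Local Notation leb := (@lebesgue_measure R).
Local Open Scope ereal_scope.

Lemma ftc_comparison_itv (F F' P r : R -> R) (a b : R) :
  (forall x : R, is_derive x 1%R F (F' x)) -> continuous F' -> continuous P ->
  (forall x, (0 <= P x)%R) -> measurable_fun [set: R] r ->
  (forall x, (0 <= r x)%R) ->
  (forall x, a <= x <= b -> F' x + P x <= r x)%R -> (a <= b)%R ->
  (F b)%:E + \int[leb]_(x in `[a, b]) (P x)%:E <=
  (F a)%:E + \int[leb]_(x in `[a, b]) (r x)%:E.
Proof.
move=> dF cF' cP P0 mr r0 FPr; rewrite le_eqVlt => /predU1P[<-|ab].
  by rewrite set_itv1 !integral_set1.
have mrE D : measurable_fun D (fun x => (r x)%:E).
  exact/measurable_EFinP/measurable_funTS.
(* The function [r] is only measurable: an infinite integral makes the claim trivial, a finite one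
   makes [r] integrable. *)
have [ry|rfin] := eqVneq (\int[leb]_(x in `[a, b]) (r x)%:E) +oo.
  by rewrite ry addey// leey.
have ir : leb.-integrable `[a, b] (EFin \o r).
  apply/integrableP; split; first exact: mrE.
  under eq_integral do rewrite gee0_abs ?lee_fin//=.
  by rewrite ltey.
have ic (g : R -> R) : continuous g -> leb.-integrable `[a, b] (EFin \o g).
  move=> cg; apply: continuous_compact_integrable; first exact: segment_compact.
  exact: continuous_subspaceT.
have iFP : leb.-integrable `[a, b] (EFin \o (fun x => F' x + P x)%R).
  by apply: ic => x; apply: cvgD; [exact: cF'|exact: cP].
have cF := is_derive1_continuous dF.
have ftc : \int[leb]_(x in `[a, b]) (F' x)%:E = (F b)%:E - (F a)%:E.
  apply: continuous_FTC2 => //.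
  - exact: continuous_subspaceT.
  - split.
    + by move=> x _; exact: ex_derive.
    + by apply: cvg_at_right_filter; exact: cF.
    + by apply: cvg_at_left_filter; exact: cF.
  - by move=> x _; rewrite derive1E derive_val.
have : \int[leb]_(x in `[a, b]) (F' x + P x)%:E <=
       \int[leb]_(x in `[a, b]) (r x)%:E.
  apply: le_integral => // x; rewrite inE/= in_itv/= => xab.
  by rewrite lee_fin FPr.
under eq_integral do rewrite EFinD.
rewrite (integralD_EFin _ (ic _ cF') (ic _ cP))//=.
rewrite ftc => h.
have -> : (F b)%:E = (F a)%:E + ((F b)%:E - (F a)%:E).
  by rewrite -EFinB -EFinD addrC subrK.
by rewrite -addeA leeD2l.
Qed.

(** On [-n, n] the boundary contribution F(n) - F(-n) is nonnegative and is dropped because of its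
    sign, not because of decay at infinity. Monotone convergence in n then gives the whole line. *)
Lemma ftc_comparison (F F' P r : R -> R) :
  (forall x : R, is_derive x 1%R F (F' x)) -> continuous F' -> continuous P ->
  (forall x, (0 <= P x)%R) -> measurable_fun [set: R] r ->
  (forall x, (0 <= r x)%R) ->
  (forall x, F' x + P x <= r x)%R ->
  (forall x : R, (0 <= x)%R -> (F (- x) <= F x)%R) ->
  \int[leb]_x (P x)%:E <= \int[leb]_x (r x)%:E.
Proof.
move=> dF cF' cP P0 mr r0 FPr FN.
pose D n : set R := [set` `[(- n%:R)%R, n%:R%R]].
have DT : \bigcup_n D n = [set: R].
  apply/seteqP; split => // x _; exists (Num.truncn `|x|).+1 => //=.
  by rewrite /D/= in_itv/= -ler_norml ltW// truncnS_gt.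
have ndD : nondecreasing_seq D.
  move=> m n mn; apply/subsetPset => x; rewrite /D/= !in_itv/= -!ler_norml.
  by move/le_trans; apply; rewrite ler_nat.
have mP : measurable_fun [set: R] (fun x => (P x)%:E).
  by apply/measurable_EFinP; exact: continuous_measurable_fun.
have cvgP : \int[leb]_(x in D n) (P x)%:E @[n --> \oo] -->
    \int[leb]_x (P x)%:E.
  rewrite -DT; apply: ge0_nondecreasing_set_cvg_integral => //.
  - by move=> n; exact: measurable_itv.
  - by move=> n; exact: measurable_funTS.
  - by move=> n x _; rewrite lee_fin.
apply: (cvge_to_le cvgP); apply: nearW => n.
apply: (@le_trans _ _ (\int[leb]_(x in D n) (r x)%:E)).
  have /(_ (- n%:R)%R n%:R) := ftc_comparison_itv dF cF' cP P0 mr r0.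
  move=> /(_ (fun x _ => FPr x)).
  have nn : (- n%:R <= n%:R :> R)%R by rewrite (@le_trans _ _ 0%R)// oppr_le0.
  move=> /(_ nn) h.
  have FNE : (F (- n%:R))%:E <= (F n%:R)%:E by rewrite lee_fin FN.
  by have := le_trans (leeD2r _ FNE) h; rewrite leeD2lE.
apply: ge0_subset_integral => //; first exact: measurable_itv.
- exact/measurable_EFinP.
- by move=> x _; rewrite lee_fin.
Qed.

End ftc_comparison.

(** * The truncated square and its derivative *)

Section test_function.
Context {R : realType}.
Implicit Types (s x : R) (q : nat).

(* Comparable to [s_+ ^ 2] at infinity; the zero of order [2 q + 2] at the
   origin is what lets [saturation_young] absorb the derivative for every
   exponent [b <= 2 q + 2]. *)
Definition truncated_square q s : R :=
  Num.max s 0 ^+ (q.*2).+2 * ((1 + s ^+ 2)^-1) ^+ q.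

Definition saturation s : R := Num.max s 0 ^+ 2 / (1 + s ^+ 2).

Let sqr1 s : 0 < 1 + s ^+ 2.
Proof. by rewrite ltr_pwDl// sqr_ge0. Qed.

Lemma saturation_ge0 s : 0 <= saturation s.
Proof. by rewrite divr_ge0 ?sqr_ge0// ltW. Qed.

Lemma saturation_le1 s : saturation s <= 1.
Proof.
rewrite ler_pdivrMr// mul1r; have [s0|s0] := leP s 0.
  by rewrite expr0n/= ltW.
by rewrite lerDr.
Qed.

Lemma truncated_squareE q s :
  truncated_square q s = Num.max s 0 ^+ 2 * saturation s ^+ q.
Proof.
by rewrite /truncated_square /saturation expr_div_n -exprM mul2n mulrA -exprD
  exprVn.
Qed.

Lemma truncated_square_ge0 q s : 0 <= truncated_square q s.
Proof. by rewrite truncated_squareE mulr_ge0 ?sqr_ge0 ?exprn_ge0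
  ?saturation_ge0. Qed.

Lemma truncated_square_le q s : truncated_square q s <= Num.max s 0 ^+ 2.
Proof.
rewrite truncated_squareE ler_piMr ?sqr_ge0//.
by rewrite exprn_ile1 ?saturation_ge0 ?saturation_le1.
Qed.

(** For s > 0, with u = s [saturation](s)^q, the product rule gives (2q + 2) u - 2q u
    [saturation](s). Since [saturation] is at most 1, the absolute value is at most (4q + 2) u. *)
Lemma truncated_square_deriv q : exists h' : R -> R,
  [/\ forall s, is_derive s 1 (truncated_square q) (h' s),
      continuous h' &
      forall s, `|h' s| <= (4 * q%:R + 2) * (Num.max s 0 * saturation s ^+ q)].
Proof.
pose d s := (1 + s ^+ 2)^-1.
have dd s : is_derive s 1 d (- d s ^+ 2 * (2 * s)).
  have dq : is_derive s 1 (fun y : R => 1 + y ^+ 2) (2 * s).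
    have := is_deriveD (is_derive_cst (1 : R) s 1) (is_deriveX 2 (is_derive_id
      s 1)).
    by rewrite exprfctE /GRing.scale/= mulr1 add0r expr1.
  have := @is_deriveV _ (fun y : R => 1 + y ^+ 2) _ _ _ (lt0r_neq0 (sqr1 s)) dq.
  by rewrite /GRing.scale/= exprVn.
have cd := is_derive1_continuous dd.
have dX n : continuous (fun s => d s ^+ n).
  move=> s; apply: (cvg_comp d (@GRing.exp R ^~ n)); first exact: cd.
  exact: exprn_continuous.
exists (fun s => (q.*2).+2%:R * Num.max s 0 ^+ (q.*2).+1 * d s ^+ q +
  Num.max s 0 ^+ (q.*2).+2 * (q%:R * d s ^+ q.-1 * (- d s ^+ 2 * (2 * s)))).
split => [s|s|s].
- have := is_deriveM (is_derive_pos_partX (q.*2) s) (is_deriveX q (dd s)).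
  rewrite /GRing.scale/= exprfctE addrC => h.
  by apply: is_derive_eq; rewrite [X in X + _]mulrC.
- apply: cvgD.
    apply: cvgM; last exact: dX.
    by apply: cvgM; [exact: cvg_cst|exact: continuous_pos_partX].
  apply: cvgM; first exact: continuous_pos_partX.
  apply: cvgM; first by apply: cvgM; [exact: cvg_cst|exact: dX].
  apply: cvgM; first by apply: cvgN; exact: dX.
  by apply: cvgM; [exact: cvg_cst|exact: cvg_id].
- have [s0|s0] := leP s 0.
    by rewrite !expr0n/= !(mul0r, mulr0) addr0 normr0.
  have sat0 := saturation_ge0 s; have sat1 := saturation_le1 s.
  have satE : saturation s = s ^+ 2 * d s by rewrite /saturation max_l// ltW.
  have d0 : 0 < d s by rewrite invr_gt0.
  have E1 : s ^+ (q.*2).+1 * d s ^+ q = s * saturation s ^+ q.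
    by rewrite satE exprMn -exprM mul2n mulrA -exprS.
  have E2 : s ^+ (q.*2).+2 * (q%:R * d s ^+ q.-1 * (- d s ^+ 2 * (2 * s))) =
      - (2 * q%:R * (s * saturation s ^+ q) * saturation s).
    rewrite -E1 satE; case: q {E1} => [|q];
      first by rewrite !(mul0r, mulr0) oppr0.
    rewrite /= !exprS; ring.
  rewrite E2 -mulrA E1 (le_trans (ler_normB _ _))//.
  have u0 : 0 <= s * saturation s ^+ q by rewrite mulr_ge0 ?exprn_ge0//;
    apply: ltW.
  set u := s * _ in u0 *.
  have A0 : 0 <= (q.*2).+2%:R * u by exact: mulr_ge0.
  have B0 : 0 <= 2 * q%:R * u by apply: mulr_ge0 => //; exact: mulr_ge0.
  rewrite (ger0_norm A0) ger0_norm; last exact: mulr_ge0.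
  have : 2 * q%:R * u * saturation s <= 2 * q%:R * u by exact: ler_piMr.
  have -> : (q.*2).+2%:R = 2 * q%:R + 2 :> R.
    by rewrite -addn2 natrD -mul2n natrM.
  lra.
Qed.

End test_function.

(** * A Young inequality weighted by the saturation *)

Section scalar.
Context {R : realType}.
Implicit Types (s x t : R) (q : nat).

(** The energy offers d / (s + 2), whereas plain Young would produce d / s, which is too large near
    s = 0. The factor [saturation](s)^q is of order s^(2q) there and compensates for the difference
    as soon as b <= 2q + 2. *)
Lemma saturation_young (a b e : R) q : 1 < a -> a^-1 + b^-1 = 1 ->
  b <= q%:R * 2 + 2 -> 0 < e ->
  exists2 C : R, 0 <= C & forall s X d, 0 < s -> 0 <= X -> 0 <= d ->
    s * saturation s ^+ q * X * d <=
    e * (s ^+ 2 * saturation s ^+ q * X `^ a) +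
    C * ((s + 2) ^+ 2 * (d / (s + 2)) `^ b).
Proof.
move=> a1 ab bq e0.
have a0 : 0 < a by rewrite (lt_trans _ a1).
have bE : b^-1 = 1 - a^-1 by rewrite -ab addrC addKr.
have b0 : 0 < b.
  by rewrite -invr_gt0 bE subr_gt0 invf_lt1.
have b1 : 0 < b - 1.
  rewrite subr_gt0 -(invrK b) invf_gt1 ?invr_gt0//.
  by rewrite bE gtrBl invr_gt0.
have abM : (a - 1) * (b - 1) = 1.
  have : a * b * (a^-1 + b^-1) = a * b by rewrite ab mulr1.
  rewrite mulrDr mulrAC divff ?gt_eqF// mul1r mulfK ?gt_eqF//.
  by move=> h; rewrite mulrBl mulrBr; lra.
(* The 5^q comes from the bound [rho] on [saturation], the power of 1/e from inverting the threshold
   on [d] below. *)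
exists (5 ^+ q * e^-1 `^ (b - 1)).
  by rewrite mulr_ge0// ?exprn_ge0// powR_ge0.
move=> s X d s0 X0 d0.
have sat0 := saturation_ge0 s.
have rq0 : 0 <= saturation s ^+ q by rewrite exprn_ge0.
have t0 : 0 < s + 2 by rewrite addr_gt0.
(* Below this threshold the first term alone suffices. Above it, (a - 1)(b - 1) = 1 turns the
   inequality into an upper bound on [X], and the second term suffices. *)
have [dle|dgt] := leP d (e * s * X `^ (a - 1)).
  rewrite (@le_trans _ _ (e * (s ^+ 2 * saturation s ^+ q * X `^ a)))//;
    last first.
    by rewrite lerDl !mulr_ge0 ?sqr_ge0 ?exprn_ge0 ?powR_ge0// ltW.
  rewrite -(mulr_powRB1 X0 a0).
  apply: (@le_trans _ _ (s * saturation s ^+ q * X * (e * s * X `^ (a - 1)))).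
    by rewrite ler_wpM2l// !mulr_ge0// ltW.
  by rewrite le_eqVlt; apply/orP; left; apply/eqP; ring.
have es0 : 0 < e * s by rewrite mulr_gt0.
have Xle : X <= (d / (e * s)) `^ (b - 1).
  have -> : X = (X `^ (a - 1)) `^ (b - 1) by rewrite -powRrM abM powRr1.
  apply: ge0_ler_powR; rewrite ?nnegrE ?powR_ge0// ?divr_ge0// ?(ltW b1)//.
    exact: ltW.
  by rewrite ler_pdivlMr// mulrC ltW.
rewrite (@le_trans _ _ (5 ^+ q * e^-1 `^ (b - 1) *
    ((s + 2) ^+ 2 * (d / (s + 2)) `^ b)))//; last first.
  rewrite lerDr !mulr_ge0 ?powR_ge0 ?exprn_ge0//; exact: ltW.
set l := s / (s + 2).
have l0 : 0 < l by rewrite divr_gt0.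
have l1 : l <= 1 by rewrite ler_pdivrMr// mul1r lerDl.
set y := d / (s + 2).
have y0 : 0 <= y by rewrite divr_ge0// ltW.
have sE : s = (s + 2) * l by rewrite /l mulrC divfK// gt_eqF.
have dE : d = (s + 2) * y by rewrite /y mulrC divfK// gt_eqF.
have dsE : d / (e * s) = e^-1 * y / l.
  rewrite /y /l; field; rewrite ?gt_eqF//.
(* This reduces to (s + 2)^2 <= 5 (1 + s^2), that is, to (2s - 1)^2 >= 0. *)
have rho : saturation s <= 5 * l ^+ 2.
  rewrite /saturation max_l ?(ltW s0)// /l expr_div_n.
  rewrite ler_pdivrMr ?ltr_pwDl ?sqr_ge0//.
  rewrite [leRHS](_ : _ = s ^+ 2 * (5 * (1 + s ^+ 2)) / (s + 2) ^+ 2);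
    last by ring.
  rewrite ler_pdivlMr ?exprn_gt0// ler_wpM2l ?sqr_ge0//.
  by have := sqr_ge0 (2 * s - 1); lra.
apply: (@le_trans _ _ ((s + 2) ^+ 2 *
    (l * (5 * l ^+ 2) ^+ q * (d / (e * s)) `^ (b - 1) * y))).
  rewrite [X in X * _ * _ * _ <= _]sE [X in _ * X <= _]dE.
  rewrite [leLHS](_ : _ = (s + 2) ^+ 2 * (l * saturation s ^+ q * X * y));
    last by ring.
  rewrite ler_wpM2l ?sqr_ge0// ler_wpM2r// ler_pM//.
  - by rewrite mulr_ge0// ltW.
  - apply: ler_wpM2l; first exact: ltW.
    by apply: lerXn2r; rewrite ?nnegrE// mulr_ge0// sqr_ge0.
rewrite [leRHS]mulrCA ler_wpM2l ?sqr_ge0// dsE.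
(* Here [bq] enters: l <= 1 and 2q + 1 >= b - 1. *)
have lq : l * (l ^+ 2) ^+ q <= l `^ (b - 1).
  rewrite -exprM -exprS -powR_mulrn ?(ltW l0)//.
  apply: ger_powR; first by rewrite l0.
  by rewrite -addn1 natrD natrM mulrC; lra.
rewrite exprMn -(mulr_powRB1 y0 b0).
apply: (@le_trans _ _
    (5 ^+ q * (l `^ (b - 1)) * (e^-1 * y / l) `^ (b - 1) * y)).
  rewrite ler_wpM2r// ler_wpM2r ?powR_ge0// mulrCA ler_wpM2l ?exprn_ge0//.
have -> : 5 ^+ q * l `^ (b - 1) * (e^-1 * y / l) `^ (b - 1) =
   5 ^+ q * (e^-1 `^ (b - 1) * y `^ (b - 1)).
  have ey0 : 0 <= e^-1 * y by rewrite mulr_ge0// invr_ge0 ltW.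
  have l0' := ltW l0.
  have eyl0 : 0 <= e^-1 * y / l by exact: divr_ge0.
  rewrite -mulrA -(powRM _ l0' eyl0).
  rewrite (mulrC l) divfK ?gt_eqF// powRM// ?invr_ge0 ?ltW//.
by rewrite le_eqVlt; apply/orP; left; apply/eqP; ring.
Qed.

End scalar.

(** * Continuity of the weights and derivatives of the multipliers *)

Section weights.
Context {R : realType}.
Implicit Types (x y a : R).

Lemma continuous_norm_powR a : 1 <= a -> continuous (fun x => `|x| `^ a).
Proof.
move=> a1 x; have a0 : 0 < a by rewrite (lt_le_trans _ a1).
have [->|x0] := eqVneq x 0.
  rewrite /continuous_at normr0 powR0 ?gt_eqF//.
  (* The derivative of the power is used only at positive points; at 0, |y|^a is squeezed between 0
     and |y|. *)
  apply: (@squeeze_cvgr _ _ _ _ (cst 0) (fun y => `|y|)); last 2 first.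
  - exact: cvg_cst.
  - by have := @norm_continuous _ R^o 0; rewrite /continuous_at normr0.
  near=> y; rewrite powR_ge0/=.
  have [->|y0] := eqVneq y 0; first by rewrite normr0 powR0 ?gt_eqF.
  apply: ge1r_powR => //; rewrite normr_gt0 y0/=.
  near: y; apply/nbhs_ballP; exists 1 => //= z.
  by rewrite /ball/= sub0r normrN => /ltW.
have xp : 0 < `|x| by rewrite normr_gt0.
apply: (@continuous_comp R R R (fun y => `|y|) (fun y => y `^ a) x).
  exact: (@norm_continuous _ R^o x).
apply: differentiable_continuous; apply/derivable1_diffP.
exact: (@ex_derive _ _ _ _ _ _ _ (is_derive1_powR a xp)).
Unshelve. all: by end_near. Qed.

Lemma continuous_expabs a : 1 <= a -> continuous (expabs a).
Proof.
move=> a1 x; apply: continuous_comp; last exact: continuous_expR.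
by apply: (@continuousN _ R^o); exact: continuous_norm_powR.
Qed.

Lemma is_derive_expRN_powR a y : 0 < y ->
  is_derive y 1 (fun z => expR (- (z `^ a)))
    (expR (- (y `^ a)) * (- (a * y `^ (a - 1)))).
Proof.
move=> y0; have dp := is_derive1_powR a y0.
have dN := is_deriveN dp.
exact: (is_derive1_comp (is_derive_expR _) dN).
Qed.

(** The multiplier for 1 < a: the negative term - a |x|^a of its derivative is what controls the
    moment of order a. *)
Lemma is_derive_mulx_expabs a x : 1 <= a ->
  is_derive x 1 (fun y => y * expabs a y)
    (expabs a x * (1 - a * `|x| `^ a)).
Proof.
move=> a1; have a0 : 0 < a by rewrite (lt_le_trans _ a1).
have := @is_derive_mulx_even _ _ _ x (@is_derive_expRN_powR a).
move=> /(_ (@continuous_expabs _ a1 0)) h.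
  apply: is_derive_eq; rewrite /expabs; set e := expR _.
  by rewrite -(mulr_powRB1 (normr_ge0 x) a0); ring.
Qed.

(** The multiplier for a = 1, bounded relative to the density. The coefficient of the density in its
    derivative tends to -1 at infinity, so it controls the test function itself rather than a
    moment. *)
Lemma is_derive_mulx_expabs1 x :
  is_derive x 1 (fun y => y * (expabs 1 y / (1 + `|y|)))
    (expabs 1 x * ((1 - `|x| - `|x| ^+ 2) / (1 + `|x|) ^+ 2)).
Proof.
have dk y : 0 < y -> is_derive y 1 (fun z => expR (- (z `^ 1)) / (1 + z))
    (- (expR (- (y `^ 1)) * ((1 + y)^-1 + (1 + y) ^- 2))).
  move=> y0; have y1 : 1 + y != 0 by rewrite gt_eqF// addr_gt0.
  have d1 := is_derive_expRN_powR 1 y0.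
  have d2 : is_derive y 1 (fun z : R => 1 + z) 1.
    have := is_deriveD (is_derive_cst (1 : R) y 1) (is_derive_id y 1).
    by rewrite add0r.
  have d3 := @is_deriveV _ (fun z : R => 1 + z) _ _ _ y1 d2.
  have d4 := is_deriveM d1 d3.
  by apply: is_derive_eq; rewrite /GRing.scale/= subrr powRr0; ring.
have ck : {for 0, continuous (fun y : R => expR (- (`|y| `^ 1)) / (1 + `|y|))}.
  apply: cvgM; first exact: (@continuous_expabs 1 (lexx _) 0).
  apply: cvgV; first by rewrite normr0 addr0 oner_eq0.
  by apply: cvgD; [exact: cvg_cst|exact: (@norm_continuous _ R^o 0)].
have h := is_derive_mulx_even x dk ck.
apply: is_derive_eq; rewrite /expabs; field.
by rewrite gt_eqF// ltr_pwDl.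
Qed.

End weights.

(** * Integration by parts with an odd multiplier *)

Section weighted_comparison.
Context {R : realType}.
Local Notation leb := (@lebesgue_measure R).

(** This is [ftc_comparison] for F = G h(f). As G is odd and nonnegative on the right half-line and
    h >= 0, F(-x) <= 0 <= F(x) for x >= 0, which is the required sign at the boundary. *)
Lemma weighted_comparison (G G' h h' f f' P r : R -> R) :
  (forall x : R, is_derive x 1 G (G' x)) -> continuous G' ->
  (forall x : R, G (- x) = - G x) -> (forall x : R, 0 <= x -> 0 <= G x) ->
  (forall x : R, is_derive x 1 h (h' x)) -> continuous h' ->
  (forall x, 0 <= h x) ->
  (forall x : R, is_derive x 1 f (f' x)) -> continuous f' ->
  continuous P -> (forall x, 0 <= P x) ->
  measurable_fun [set: R] r -> (forall x, 0 <= r x) ->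
  (forall x, G' x * h (f x) + G x * (h' (f x) * f' x) + P x <= r x) ->
  (\int[leb]_x (P x)%:E <= \int[leb]_x (r x)%:E)%E.
Proof.
move=> dG cG' GN G0 dh ch' h0 df cf' cP P0 mr r0 le.
have cG := is_derive1_continuous dG.
have ch := is_derive1_continuous dh; have cf := is_derive1_continuous df.
apply: (@ftc_comparison _ (fun x => G x * h (f x))
  (fun x => G' x * h (f x) + G x * (h' (f x) * f' x))) => //.
- move=> x; have dhf := is_derive1_comp (dh (f x)) (df x).
  have := is_deriveM (dG x) dhf.
  by rewrite /GRing.scale/= addrC [h (f x) * _]mulrC.
- move=> x; apply: cvgD; apply: cvgM.
  + exact: cG'.
  + by apply: (cvg_comp f h); [exact: cf|exact: ch].
  + exact: cG.
  + apply: cvgM; last exact: cf'.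
    by apply: (cvg_comp f h'); [exact: cf|exact: ch'].
- move=> x x0; rewrite GN (@le_trans _ _ 0)//.
    by rewrite mulNr oppr_le0 mulr_ge0// G0.
  by rewrite mulr_ge0// G0.
Qed.

End weighted_comparison.

(** * The energy and the moment bound *)

Section energy.
Context {R : realType}.
Local Notation leb := (@lebesgue_measure R).
Implicit Types (x y a b : R) (f : R -> R).

(** The integrand of the quantity w, taken against Lebesgue measure without the factor 1 / [Zalpha].
    The f^2 part is later charged to the variance, the other part is the gradient term. *)
Definition energy a b f (f' : R -> R) x : R :=
  \1_[set y | 2 <= f y] x * (f x ^+ 2 * (1 + `|f' x / f x| `^ b)) * expabs a x.

Lemma energy_ge0 a b f f' x : 0 <= energy a b f f' x.
Proof.
apply: mulr_ge0; last exact: expabs_ge0.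
apply: mulr_ge0 => //; apply: mulr_ge0; first exact: sqr_ge0.
by rewrite addr_ge0// powR_ge0.
Qed.

Lemma energyE a b f f' x : 2 <= f x ->
  energy a b f f' x = f x ^+ 2 * (1 + (`|f' x| / f x) `^ b) * expabs a x.
Proof.
move=> f2; rewrite /energy indicE mem_set// mul1r normf_div.
by rewrite (ger0_norm (le_trans _ f2)).
Qed.

Lemma measurable_level d (T : measurableType d) (f : T -> R) (c : R) :
  measurable_fun [set: T] f ->
  measurable [set y | c <= f y].
Proof.
move=> mf; rewrite (_ : [set y | _] = f @^-1` `[c, +oo[).
  by rewrite -[X in measurable X]setTI; exact: mf.
by apply/seteqP; split => y /=; rewrite in_itv/= andbT.
Qed.

Lemma level3_entropy_ge0 T (f : T -> R) (t : T) :
  0 <= \1_[set y | 3 <= f y] t * (f t ^+ 2 * ln (f t ^+ 2)) :> R.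
Proof.
rewrite indicE; have [fx3|fx3] := leP 3 (f t); last first.
  by rewrite memNset/= ?mul0r//; apply/negP; rewrite -ltNge.
rewrite mem_set// mul1r mulr_ge0 ?sqr_ge0// ln_ge0// exprn_ege1//.
by rewrite (le_trans _ fx3)// ler1n.
Qed.

Lemma measurable_level3_entropy d (T : measurableType d) (f : T -> R) :
  measurable_fun [set: T] f ->
  measurable_fun [set: T]
    (fun x : T => \1_[set y | 3 <= f y] x * (f x ^+ 2 * ln (f x ^+ 2)) : R).
Proof.
move=> mf; apply: measurable_funM.
  exact: (measurable_indic (measurable_level _ mf)).
apply: measurable_funM; first exact: measurable_funX.
by apply: (measurableT_comp (@measurable_ln R)); exact: measurable_funX.
Qed.

Lemma measurable_fun_divr f (g : R -> R) : measurable_fun [set: R] f ->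
  measurable_fun [set: R] g -> (forall x, 0 <= f x) ->
  measurable_fun [set: R] (fun x => g x / f x).
Proof.
move=> mf mg f0; apply: measurable_funM => //.
(* On nonnegative reals the inverse is the power of exponent -1, including at 0, where both are
   0. *)
rewrite (_ : (fun x => _) = (fun x => f x `^ (-1))).
  exact: (measurableT_comp (measurable_powR (-1))).
by apply/funext => x; rewrite powR_inv1.
Qed.

Lemma measurable_energy a b f f' : measurable_fun [set: R] f ->
  measurable_fun [set: R] f' -> (forall x, 0 <= f x) ->
  measurable_fun [set: R] (energy a b f f').
Proof.
move=> mf mf' f0.
apply: measurable_funM; last exact: measurable_expabs.
apply: measurable_funM; first exact: (measurable_indic (measurable_level _ mf)).
apply: measurable_funM; first exact: measurable_funX.
apply: measurable_funD; first exact: measurable_cst.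
apply: (measurableT_comp (measurable_powR b)).
apply: (measurableT_comp (@normr_measurable R setT)).
exact: measurable_fun_divr.
Qed.

Lemma expabs_le1 a x : expabs a x <= 1.
Proof. by rewrite -expR0 ler_expR oppr_le0 powR_ge0. Qed.

(** With the multiplier x e^{-|x|^a} and the test function [truncated_square], the moment appears
    with coefficient -a <= -1. The cross term, bounded by [saturation_young], gives back at most
    half of it. *)
Lemma moment_le_energy a b q : 1 < a -> a^-1 + b^-1 = 1 ->
  b <= q%:R * 2 + 2 ->
  exists2 C : R, 0 <= C & forall f f' : R -> R,
    (forall x : R, is_derive x 1 f (f' x)) -> continuous f' ->
    (forall x, 0 <= f x) ->
    (\int[leb]_x (`|x| `^ a * truncated_square q (f x - 2) * expabs a x)%:E <=
     C%:E * \int[leb]_x (energy a b f f' x)%:E)%E.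
Proof.
move=> a1 ab bq.
have [h' [dh ch' h'le]] := @truncated_square_deriv R q.
set K := 4 * q%:R + 2 in h'le.
have K0 : 0 < K by rewrite ltr_wpDl// mulr_ge0.
(* The cross term carries the factor [K], so this choice of [e] makes it cost exactly half of the
   moment. *)
have [|C C0 young] := @saturation_young R a b (2 * K)^-1 q a1 ab bq.
  by rewrite invr_gt0 mulr_gt0.
have KC0 : 0 <= K * C by rewrite mulr_ge0// ltW.
(* The 2 undoes the remaining half, the 1 pays for the bare test function, which is at most f^2, and
   [K * C] for the Young remainder. *)
exists (2 * (1 + K * C)); first by rewrite mulr_ge0// addr_ge0.
move=> f f' df cf' f0.
have a1' := ltW a1.
have cf := is_derive1_continuous df.
have mf := continuous_measurable_fun cf.
have mf' := continuous_measurable_fun cf'.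
have mE := measurable_energy a b mf mf' f0.
have ch := is_derive1_continuous dh.
have dg x : is_derive x 1 (fun y => f y - 2) (f' x).
  have := is_deriveB (df x) (is_derive_cst (2 : R) x 1).
  by rewrite subr0.
have cg : continuous (fun y => f y - 2).
  by move=> x; apply: cvgB; [exact: cf|exact: cvg_cst].
have cP : continuous
    (fun x => `|x| `^ a * truncated_square q (f x - 2) * expabs a x).
  move=> x; apply: cvgM; last exact: continuous_expabs.
  apply: cvgM; first exact: continuous_norm_powR.
  apply: (@continuous_comp R R R (fun y => f y - 2) (truncated_square q) x).
    exact: cg.
  exact: ch.
have P0 x : 0 <= `|x| `^ a * truncated_square q (f x - 2) * expabs a x.
  by rewrite mulr_ge0 ?expabs_ge0// mulr_ge0 ?powR_ge0 ?truncated_square_ge0.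
suff : (\int[leb]_x (2^-1 *
         (`|x| `^ a * truncated_square q (f x - 2) * expabs a x))%:E <=
       \int[leb]_x ((1 + K * C) * energy a b f f' x)%:E)%E.
  under eq_integral do rewrite EFinM.
  under [X in (_ <= X)%E -> _]eq_integral do rewrite EFinM.
  have mP := continuous_measurable_fun cP.
  rewrite ge0_integralZl//; last 2 first.
    exact/measurable_EFinP.
    by move=> x _; rewrite lee_fin.
  rewrite ge0_integralZl//; last 3 first.
    exact/measurable_EFinP.
    by move=> x _; rewrite lee_fin energy_ge0.
    by rewrite lee_fin addr_ge0.
  rewrite EFinM -muleA => h.
  rewrite -lee_pdivrMl//.
apply: (@weighted_comparison _ (fun y => y * expabs a y)
  (fun y => expabs a y * (1 - a * `|y| `^ a))
  (truncated_square q) h' (fun y => f y - 2) f') => //.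
- by move=> x; exact: is_derive_mulx_expabs.
- move=> x; apply: cvgM; first exact: continuous_expabs.
  apply: cvgB; first exact: cvg_cst.
  by apply: cvgM; [exact: cvg_cst|exact: continuous_norm_powR].
- by move=> x; rewrite /expabs normrN mulNr.
- by move=> x x0; rewrite mulr_ge0// expabs_ge0.
- by move=> x; exact: truncated_square_ge0.
- by move=> x; apply: cvgM; [exact: cvg_cst|exact: cP].
- by move=> x; rewrite mulr_ge0.
- by apply: measurable_funM.
- by move=> x; rewrite mulr_ge0 ?energy_ge0// addr_ge0.
move=> x; have := h'le (f x - 2); set s := f x - 2.
(* Where f <= 2 the test function and its derivative vanish. *)
have [s0|s0] := leP s 0.
  rewrite mul0r mulr0 normr_le0 => /eqP ->.
  have -> : truncated_square q s = 0.
    by rewrite /truncated_square max_r// expr0n/= mul0r.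
  by rewrite !(mulr0, mul0r) !addr0 mulr_ge0 ?energy_ge0// addr_ge0.
move=> h's.
have fE : f x = s + 2 by rewrite /s subrK.
have f2 : 2 <= f x by rewrite fE lerDr ltW.
have Xa0 := powR_ge0 `|x| a; have E0 := expabs_ge0 a x.
rewrite energyE// fE.
have := young s `|x| `|f' x| s0 (normr_ge0 _) (normr_ge0 _).
set V := (s + 2) ^+ 2 * _; set u := s * saturation s ^+ q => yg.
have TE : truncated_square q s = s ^+ 2 * saturation s ^+ q.
  by rewrite truncated_squareE max_l// ltW.
have Tle : truncated_square q s <= (s + 2) ^+ 2.
  rewrite (le_trans (truncated_square_le _ _))// max_l ?(ltW s0)//.
  lra.
have T0 := truncated_square_ge0 q s.
have V0 : 0 <= V by rewrite mulr_ge0 ?sqr_ge0 ?powR_ge0.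
have B1 : x * h' s * f' x <= K * (u * `|x| * `|f' x|).
  rewrite (le_trans (ler_norm _))// !normrM.
  rewrite [leRHS](_ : _ = `|x| * (K * u) * `|f' x|); last by ring.
  by rewrite ler_wpM2r// ler_wpM2l.
have B2 : K * (u * `|x| * `|f' x|) <=
  2^-1 * (`|x| `^ a * truncated_square q s) + K * C * V.
  rewrite (le_trans (ler_wpM2l (ltW K0) yg))// -TE mulrDr.
  by rewrite le_eqVlt; apply/orP; left; apply/eqP; field; rewrite gt_eqF.
have B3 : truncated_square q s * (`|x| `^ a) <=
  a * (truncated_square q s * (`|x| `^ a)).
  by rewrite ler_peMl// mulr_ge0.
rewrite [leLHS](_ : _ = ((1 - a * `|x| `^ a) * truncated_square q s
    + x * h' s * f' x + 2^-1 * (`|x| `^ a * truncated_square q s)) *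
    expabs a x); last by ring.
rewrite [leRHS]mulrA ler_wpM2r// [X in _ <= _ * X]mulrDr mulr1 -/V.
have : 0 <= K * C * (s + 2) ^+ 2 by rewrite mulr_ge0 ?sqr_ge0.
lra.
Qed.

End energy.

(** * Entropy on high levels for 1 < a *)

Section entropy_gt1.
Context {R : realType}.
Local Notation leb := (@lebesgue_measure R).
Implicit Types (x y a b : R).

Lemma expabs_gt0 a x : 0 < expabs a x.
Proof. exact: expR_gt0. Qed.

Lemma ler_expabs a x y : 0 <= a -> `|x| <= `|y| -> expabs a y <= expabs a x.
Proof. by move=> a0 xy; rewrite ler_expR lerN2 ge0_ler_powR ?nnegrE. Qed.

Lemma le_1D_powR y b : 0 <= y -> 1 <= b -> y <= 1 + y `^ b.
Proof.
move=> y0 b1; have [y1|/ltW y1] := leP y 1.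
  by rewrite (le_trans y1)// lerDl powR_ge0.
by rewrite (le_trans (le1r_powR y1 b1))// lerDr.
Qed.

Lemma sqr_le_level3 (t : R) : 3 <= t -> t ^+ 2 <= 9 * (t - 2) ^+ 2.
Proof.
move=> t3; have : 0 <= (t - 3) * (8 * t - 12) by rewrite mulr_ge0; lra.
nra.
Qed.

(** A path from a point of [-T, T] to x only meets points z of these two kinds. The product bounds
    the density from below in both cases because each factor is at most 1. *)
Lemma expabs_mul_le a (T x z : R) : 0 <= a ->
  `|z| <= `|x| \/ `|z| <= T -> expabs a T * expabs a x <= expabs a z.
Proof.
move=> a0; case=> [zx|zT].
  apply: le_trans (ler_expabs a0 zx).
  by rewrite ler_piMl ?expabs_ge0 ?expabs_le1.
apply: (@le_trans _ _ (expabs a T)).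
  by rewrite ler_piMr ?expabs_ge0 ?expabs_le1.
by rewrite ler_expabs// (le_trans zT)// ler_norm.
Qed.

(** The derivative of [H] = (f - 2)_+^2 is integrated along the segment from y, where [H] vanishes,
    to x. The 18 is 2 from differentiating the square times 9 from [sqr_le_level3]. *)
Lemma level_sup_le a b (T : R) (f f' : R -> R) (w x y : R) : 1 <= a -> 1 <= b ->
  (forall x : R, is_derive x 1 f (f' x)) -> continuous f' ->
  (forall x, 0 <= f x) ->
  (\int[leb]_x (energy a b f f' x)%:E = w%:E)%E ->
  `|y| <= T -> f y < 2 -> 3 <= f x ->
  f x ^+ 2 * expabs a x <= 18 / expabs a T * w.
Proof.
move=> a1 b1 df cf' f0 ew.
have a0 := le_trans ler01 a1.
have cf := is_derive1_continuous df.
have mf := continuous_measurable_fun cf.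
have mf' := continuous_measurable_fun cf'.
have mE := measurable_energy a b mf mf' f0.
have dg (z : R) : is_derive z 1 (fun y => f y - 2) (f' z).
  have := is_deriveB (df z) (is_derive_cst (2 : R) z 1).
  by rewrite subr0.
pose H z : R := Num.max (f z - 2) 0 ^+ 2.
pose H' z : R := 2 * Num.max (f z - 2) 0 * f' z.
have dH (z : R) : is_derive z 1 H (H' z).
  have := @is_derive1_comp R (fun s => Num.max s 0 ^+ 2) (fun y => f y - 2) z
    _ _
    (is_derive_pos_partX 0 (f z - 2)) (dg z).
  by rewrite expr1.
have cH' : continuous H'.
  move=> z; apply: cvgM; last exact: cf'.
  apply: cvgM; first exact: cvg_cst.
  apply: (@continuous_comp R R R (fun y => f y - 2) (fun s => Num.max s 0) z).
    by apply: cvgB; [exact: cf|exact: cvg_cst].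
  exact: continuous_pos_part.
have Ex0 := expabs_gt0 a x; have ET0 := expabs_gt0 a T.
(* The denominator is the lower bound of [expabs_mul_le] for the density along the path; dividing by
   it makes up for the weight contained in [energy]. *)
pose c := 2 / (expabs a T * expabs a x).
have c0 : 0 <= c.
  exact: (divr_ge0 (ler0n _ 2) (ltW (mulr_gt0 ET0 Ex0))).
have bound z : `|z| <= `|x| \/ `|z| <= T -> `|H' z| <= c * energy a b f f' z.
  move=> zxT; rewrite /H'; have [z2|z2] := leP (f z - 2) 0.
    by rewrite mulr0 mul0r normr0 mulr_ge0// energy_ge0.
  have fz2 : 2 <= f z by rewrite -subr_ge0 ltW.
  have fz0 : 0 < f z by rewrite (lt_le_trans _ fz2).
  rewrite energyE// !normrM normr_nat (gtr0_norm z2).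
  have Ez := expabs_mul_le a0 zxT.
  set v := _ / f z.
  have v0 : 0 <= v by rewrite divr_ge0.
  have f'E : `|f' z| = f z * v by rewrite /v mulrC divfK ?gt_eqF.
  have vb := le_1D_powR v0 b1.
  apply: (@le_trans _ _ (2 * (f z ^+ 2 * (1 + v `^ b)))).
    rewrite f'E -mulrA ler_wpM2l// mulrA expr2 ler_pM//.
    - by rewrite mulr_ge0 ?(ltW z2).
    - by rewrite ler_wpM2r// gerBl.
  rewrite [leRHS](_ : _ = 2 * (f z ^+ 2 * (1 + v `^ b)) *
    (expabs a z / (expabs a T * expabs a x))); last by rewrite /c; ring.
  rewrite ler_peMr//; last first.
    by rewrite ler_pdivlMr; [rewrite mul1r|exact: mulr_gt0].
  by rewrite mulr_ge0// mulr_ge0 ?sqr_ge0// addr_ge0// powR_ge0.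
have int_le D : measurable D ->
    (\int[leb]_(z in D) (c * energy a b f f' z)%:E <= (c * w)%:E)%E.
  move=> mD; apply: (@le_trans _ _ (\int[leb]_z (c * energy a b f f' z)%:E)%E).
    apply: ge0_subset_integral => //.
    - by apply/measurable_EFinP; exact: measurable_funM.
    - by move=> z _; rewrite lee_fin mulr_ge0// energy_ge0.
  under eq_integral do rewrite EFinM.
  rewrite ge0_integralZl ?ew//.
  - exact/measurable_EFinP.
  - by move=> z _; rewrite lee_fin energy_ge0.
have mcE : measurable_fun [set: R] (fun z => c * energy a b f f' z).
  exact: measurable_funM.
have cE0 z : 0 <= c * energy a b f f' z by rewrite mulr_ge0// energy_ge0.
move=> yT fy2 fx3.
have Hy : H y = 0 by rewrite /H max_r ?expr0n// subr_le0 ltW.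
have c00 : continuous (cst 0 : R -> R) by move=> z; exact: cvg_cst.
have Hx : H x <= c * w.
  (* To the right of y the comparison is applied to [H], to the left to - [H]. The sign of z decides
     which alternative of [bound] holds. *)
  have [yx|/ltW xy] := leP y x.
    have := @ftc_comparison_itv R H H' (cst 0) _ y x dH cH' c00
      (fun=> lexx _) mcE cE0 _ yx.
    rewrite integral0 adde0 Hy add0e => h.
    rewrite -lee_fin; apply: le_trans (int_le _ (measurable_itv `[y, x])).
    apply: h => z /andP[yz zx]; rewrite addr0 (le_trans (ler_norm _))// bound//.
    have [z0|/ltW z0] := leP 0 z.
      by left; rewrite !ger0_norm// (le_trans z0).
    by right; rewrite (le_trans _ yT)// !ler0_norm ?lerN2// (le_trans yz).
  have dN (z : R) : is_derive z 1 (fun z => - H z) (- H' z) by exact: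
    is_deriveN.
  have cN : continuous (fun z => - H' z) by move=> z; apply: cvgN; exact: cH'.
  have := @ftc_comparison_itv R _ _ (cst 0) _ x y dN cN c00
      (fun=> lexx _) mcE cE0 _ xy.
  rewrite integral0 adde0 Hy oppr0 => h.
  rewrite -lee_fin; apply: le_trans (int_le _ (measurable_itv `[x, y])).
  rewrite EFinN addeC sube_ge0// in h.
  apply: h => z /andP[xz zy]; rewrite addr0.
  rewrite (le_trans (ler_norm _))// normrN bound//.
  have [z0|/ltW z0] := leP 0 z.
    by right; rewrite (le_trans _ yT)// !ger0_norm// (le_trans z0).
  by left; rewrite !ler0_norm ?lerN2// (le_trans xz).
have : f x ^+ 2 <= 9 * H x.
  by rewrite /H max_l ?sqr_le_level3// subr_ge0; apply: le_trans fx3;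
    rewrite ler_nat.
move=> /le_trans /(_ (ler_wpM2l _ Hx)) => /(_ (ler0n _ 9)).
move/(ler_wpM2r (ltW Ex0)) => /le_trans; apply.
rewrite le_eqVlt; apply/orP; left; apply/eqP; rewrite /c; field.
by rewrite (lt0r_neq0 ET0) (lt0r_neq0 Ex0).
Qed.

(** Here t - 2 >= 1, so [saturation] is at least 1/2 and its q-th power costs only 2^q. *)
Lemma truncated_square_ge q (t : R) : 3 <= t ->
  t ^+ 2 <= 9 * 2 ^+ q * truncated_square q (t - 2).
Proof.
move=> t3; have s1 : 1 <= t - 2 by lra.
rewrite truncated_squareE max_l ?(le_trans _ s1)//.
have h2 : 2^-1 <= saturation (t - 2).
  rewrite /saturation max_l ?(le_trans _ s1)//.
  rewrite ler_pdivlMr ?ltr_pwDl ?sqr_ge0//.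
  have : 1 <= (t - 2) ^+ 2 by rewrite exprn_ege1.
  lra.
have h2q : 2^-1 ^+ q <= saturation (t - 2) ^+ q.
  by rewrite lerXn2r ?nnegrE ?saturation_ge0.
have : 1 <= 2 ^+ q * saturation (t - 2) ^+ q.
  rewrite -ler_pdivrMl ?exprn_gt0// mulr1.
  by rewrite exprVn in h2q.
move=> h; have sq := sqr_le_level3 t3.
rewrite (le_trans sq)// [leRHS](_ : _ = 9 * (t - 2) ^+ 2 *
  (2 ^+ q * saturation (t - 2) ^+ q)); last by ring.
by rewrite ler_peMr// mulr_ge0 ?sqr_ge0.
Qed.

(** The bound ln f^2 <= |x|^a + k w is multiplied by f^2. The first term is a moment, controlled by
    [moment_le_energy]; the second integrates to at most k w [Zalpha], so the result stays linear in
    w. *)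
Lemma upper_entropy_le_energy a b (T : R) : 1 < a -> a^-1 + b^-1 = 1 ->
  exists2 C : R, 0 < C & forall f f' : R -> R,
    (forall x : R, is_derive x 1 f (f' x)) -> continuous f' ->
    (forall x, 0 <= f x) ->
    (\int[leb]_x (f x ^+ 2 * expabs a x)%:E = (Zalpha a)%:E)%E ->
    (exists2 y : R, `|y| <= T & f y < 2) ->
    (\int[leb]_x (\1_[set y | (3 <= f y)%R] x * (f x ^+ 2 * ln (f x ^+ 2)) *
                  expabs a x)%:E
     <= C%:E * \int[leb]_x (energy a b f f' x)%:E)%E.
Proof.
move=> a1 ab; have a1' := ltW a1.
have a0 : 0 < a by rewrite (lt_trans _ a1).
have bE : b^-1 = 1 - a^-1 by rewrite -ab addrC addKr.
have b0 : 0 < b by rewrite -invr_gt0 bE subr_gt0 invf_lt1.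
have b1 : 1 <= b.
  by rewrite -(invrK b) invf_ge1 ?invr_gt0// bE gerBl invr_ge0 ltW.
(* Any q with b <= 2q + 2 would do; truncation gives b < q + 1. *)
pose q := Num.truncn b.
have bq : b <= q%:R * 2 + 2.
  have : b < q.+1%:R by exact: truncnS_gt.
  by rewrite -natr1; have : 0 <= q%:R :> R by []; lra.
have [C1 C10 moment] := moment_le_energy a1 ab bq.
pose k := 18 / expabs a T.
have k0 : 0 <= k by rewrite divr_ge0 ?expabs_ge0.
have Z0 := Zalpha_gt0 a1'.
have K0 : 0 <= 9 * 2 ^+ q :> R by rewrite mulr_ge0 ?exprn_ge0.
(* The moment term, the mass term, and a 1 that makes the constant positive, so that an infinite
   energy leaves nothing to prove. *)
exists (9 * 2 ^+ q * C1 + k * Zalpha a + 1).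
  by rewrite ltr_wpDl// addr_ge0// mulr_ge0// ltW.
move=> f f' df cf' f0 f2Z [y yT fy2].
have cf := is_derive1_continuous df.
have mf := continuous_measurable_fun cf.
have mf' := continuous_measurable_fun cf'.
have mE := measurable_energy a b mf mf' f0.
have en0 : (0 <= \int[leb]_x (energy a b f f' x)%:E)%E.
  by apply: integral_ge0 => x _; rewrite lee_fin energy_ge0.
have [ey|] := eqVneq (\int[leb]_x (energy a b f f' x)%:E)%E +oo%E.
  rewrite ey gt0_muley ?leey// lte_fin.
  by rewrite ltr_wpDl// addr_ge0// mulr_ge0// ltW.
move=> enfin.
have [w ew] : exists w, (\int[leb]_x (energy a b f f' x)%:E = w%:E)%E.
  exists (fine (\int[leb]_x (energy a b f f' x)%:E)).
  by rewrite fineK// ge0_fin_numE// ltey.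
have w0 : 0 <= w by rewrite -lee_fin -ew.
have sup x (fx3 : 3 <= f x) := level_sup_le a1' b1 df cf' f0 ew yT fy2 fx3.
have := moment f f' df cf' f0; rewrite ew => {}moment.
pose M x := `|x| `^ a * truncated_square q (f x - 2) * expabs a x.
have M0 x : 0 <= M x.
  by rewrite mulr_ge0 ?expabs_ge0// mulr_ge0 ?powR_ge0 ?truncated_square_ge0.
have mT : measurable_fun [set: R] (truncated_square q : R -> R).
  have [h' [dh _ _]] := @truncated_square_deriv R q.
  exact: continuous_measurable_fun (is_derive1_continuous dh).
have mM : measurable_fun [set: R] M.
  apply: measurable_funM; last exact: measurable_expabs.
  apply: measurable_funM.
    by apply: continuous_measurable_fun; exact: continuous_norm_powR.
  apply: (measurableT_comp mT).
  by apply: measurable_funB => //; exact: measurable_cst.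
have mf2 : measurable_fun [set: R] (fun x => f x ^+ 2 * expabs a x).
  by apply: measurable_funM; [exact: measurable_funX|exact: measurable_expabs].
have f20 x : 0 <= f x ^+ 2 * expabs a x by rewrite mulr_ge0 ?sqr_ge0
  ?expabs_ge0.
have kw0 : 0 <= k * w by rewrite mulr_ge0.
have le1 x : \1_[set y | 3 <= f y] x * (f x ^+ 2 * ln (f x ^+ 2)) * expabs a x
    <= 9 * 2 ^+ q * M x + k * w * (f x ^+ 2 * expabs a x).
  rewrite indicE; have [fx3|fx3] := leP 3 (f x); last first.
    rewrite memNset/=; last by apply/negP; rewrite -ltNge.
    by rewrite !mul0r addr_ge0// mulr_ge0.
  rewrite mem_set// mul1r.
  have fx0 : 0 < f x by rewrite (lt_le_trans _ fx3).
  (* The bound [sup] says f^2 <= k w e^{|x|^a}, and k w <= 1 + k w <= e^{k w}. *)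
  have lnle : ln (f x ^+ 2) <= `|x| `^ a + k * w.
    rewrite -ler_expR lnK ?posrE ?exprn_gt0// expRD.
    have := sup x fx3; rewrite -/k /expabs expRN -ler_pdivlMr ?invr_gt0
      ?expR_gt0// invrK.
    rewrite mulrC => /le_trans; apply; rewrite ler_wpM2l ?expR_ge0//.
    by rewrite (le_trans _ (expR_ge1Dx _))// lerDr.
  have tq := truncated_square_ge q fx3.
  rewrite /M; set E := expabs a x; have E0 : 0 <= E by exact: expabs_ge0.
  rewrite [leRHS](_ : _ =
    (`|x| `^ a * (9 * 2 ^+ q * truncated_square q (f x - 2)) +
      k * w * f x ^+ 2) * E); last by ring.
  rewrite ler_wpM2r//.
  apply: (@le_trans _ _ (f x ^+ 2 * (`|x| `^ a + k * w))).
    by rewrite ler_wpM2l ?sqr_ge0.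
  rewrite mulrDr [f x ^+ 2 * (k * w)]mulrC lerD2r mulrC.
  by rewrite ler_wpM2l ?powR_ge0.
apply: (@le_trans _ _ (\int[leb]_x
    ((9 * 2 ^+ q)%:E * (M x)%:E + (k * w)%:E * (f x ^+ 2 * expabs a x)%:E))%E).
  apply: ge0_le_integral => //.
  - by move=> x _; rewrite lee_fin mulr_ge0 ?level3_entropy_ge0 ?expabs_ge0.
  - apply/measurable_EFinP; apply: measurable_funM;
    last exact: measurable_expabs.
    exact: measurable_level3_entropy.
  - apply: emeasurable_funD; apply/measurable_EFinP; exact: measurable_funM.
  - by move=> x _; rewrite -!EFinM -EFinD lee_fin.
rewrite ge0_integralD//; last 4 first.
- by move=> x _; rewrite -EFinM lee_fin mulr_ge0.
- by apply/measurable_EFinP; exact: measurable_funM.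
- by move=> x _; rewrite -EFinM lee_fin mulr_ge0.
- by apply/measurable_EFinP; exact: measurable_funM.
rewrite !ge0_integralZl//; last 4 first.
- exact/measurable_EFinP.
- by move=> x _; rewrite lee_fin.
- exact/measurable_EFinP.
- by move=> x _; rewrite lee_fin.
rewrite f2Z.
apply: (@le_trans _ _ ((9 * 2 ^+ q)%:E * (C1%:E * w%:E) +
   (k * w)%:E * (Zalpha a)%:E)%E).
  by rewrite leeD2r// lee_wpmul2l ?lee_fin.
rewrite -!EFinM -EFinD lee_fin.
rewrite [leRHS](_ : _ = 9 * 2 ^+ q * (C1 * w) + k * w * Zalpha a + w);
  last by ring.
by rewrite lerDl.
Qed.

End entropy_gt1.

(** * Entropy on high levels for a = 1 *)

Section entropy_exponential.
Context {R : realType}.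
Local Notation leb := (@lebesgue_measure R).

Lemma lipschitz_derive_le1 (f f' : R -> R) (x y : R) :
  (forall z : R, is_derive z 1 f (f' z)) -> (forall z, `|f' z| <= 1) ->
  f x <= f y + `|x - y|.
Proof.
move=> df f'1.
have cf := is_derive1_continuous df.
have [yx|/ltW xy] := leP y x.
  have [c _ E] := MVT_segment yx (fun z _ => df z) (continuous_subspaceT cf).
  rewrite -lerBlDl E (le_trans (ler_norm _))// normrM.
  by rewrite ler_piMl.
have [c _ E] := MVT_segment xy (fun z _ => df z) (continuous_subspaceT cf).
rewrite -lerBlDl -opprB E (le_trans (ler_norm _))// normrN normrM distrC.
by rewrite ler_piMl.
Qed.

(** The test function (f - 2)_+^3 dominates f^2 ln f^2 where f >= 3. Far from the origin the
    multiplier has the right sign; near it the 1-Lipschitz bound keeps f below 5 + T, so that the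
    cube is at most a multiple of f^2. *)
Lemma upper_entropy_le_exponential (T : R) : 0 <= T ->
  exists2 C : R, 0 < C & forall f f' : R -> R,
    (forall x : R, is_derive x 1 f (f' x)) -> continuous f' ->
    (forall x, 0 <= f x) -> (forall x, `|f' x| <= 1) ->
    (exists2 y : R, `|y| <= T & f y < 2) ->
    (\int[leb]_x (\1_[set y | (3 <= f y)%R] x * (f x ^+ 2 * ln (f x ^+ 2)) *
                  expabs 1 x)%:E
     <= C%:E * \int[leb]_x (\1_[set y | (2 <= f y)%R] x * f x ^+ 2 *
                  expabs 1 x)%:E)%E.
Proof.
(* The summand 2 (5 + T) comes from [coef], the 3 from [young]. *)
move=> T0; pose C1 : R := 2 * (5 + T) + 3.
have C10 : 0 < C1 by rewrite /C1; lra.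
(* Where f >= 3, f^2 ln f^2 <= 2 f^3 <= 2 * 27 (f - 2)^3, and [P] contains a quarter of that
   cube. *)
exists (216 * C1); first by rewrite mulr_gt0.
move=> f f' df cf' f0 f'1 [y yT fy2].
have cf := is_derive1_continuous df.
have mf := continuous_measurable_fun cf.
have dg (x : R) : is_derive x 1 (fun y => f y - 2) (f' x).
  have := is_deriveB (df x) (is_derive_cst (2 : R) x 1).
  by rewrite subr0.
have cg : continuous (fun y => f y - 2).
  by move=> x; apply: cvgB; [exact: cf|exact: cvg_cst].
have cpos n : continuous (fun x => Num.max (f x - 2) 0 ^+ n).
  move=> x; apply: (@continuous_comp R R R (fun y => f y - 2)
    (fun s => Num.max s 0 ^+ n) x); first exact: cg.
  exact: continuous_pos_partX.
have max0 (s : R) : 0 <= Num.max s 0 by rewrite le_max lexx orbT.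
(* Of the coefficient -1 of the cube at infinity, the cross term takes 1/2 and [P] takes 1/4, which
   leaves a negative margin. *)
pose P x := 4^-1 * Num.max (f x - 2) 0 ^+ 3 * expabs 1 x.
have P0 x : 0 <= P x.
  by rewrite mulr_ge0 ?expabs_ge0// mulr_ge0// exprn_ge0.
pose r x := C1 * (\1_[set y | (2 <= f y)%R] x * f x ^+ 2 * expabs 1 x).
have m2 : measurable_fun [set: R]
    (fun x => \1_[set y | (2 <= f y)%R] x * f x ^+ 2 * expabs 1 x).
  apply: measurable_funM; last exact: measurable_expabs.
  apply: measurable_funM; last exact: measurable_funX.
  exact: (measurable_indic (measurable_level _ mf)).
have r20 x : 0 <= (\1_[set y | (2 <= f y)%R] x * f x ^+ 2 * expabs 1 x : R).
  by apply: mulr_ge0; [apply: mulr_ge0 => //; exact: sqr_ge0|exact: expabs_ge0].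
have cP : continuous P.
  move=> x; apply: cvgM; last exact: continuous_expabs.
  by apply: cvgM; [exact: cvg_cst|exact: cpos].
have PR : (\int[leb]_x (P x)%:E <= \int[leb]_x (r x)%:E)%E.
  apply: (@weighted_comparison _ (fun y => y * (expabs 1 y / (1 + `|y|)))
    (fun x => expabs 1 x * ((1 - `|x| - `|x| ^+ 2) / (1 + `|x|) ^+ 2))
    (fun s => Num.max s 0 ^+ 3) (fun s => 3 * Num.max s 0 ^+ 2)
    (fun y => f y - 2) f') => //.
  - by move=> x; exact: is_derive_mulx_expabs1.
  - move=> x; apply: cvgM; first exact: continuous_expabs.
    have cn : continuous (fun y : R => `|y|) := @norm_continuous _ R^o.
    apply: cvgM.
      apply: cvgB; first by apply: cvgB; [exact: cvg_cst|exact: cn].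
      by apply: cvgM; exact: cn.
    apply: cvgV; first by rewrite gt_eqF// exprn_gt0// ltr_pwDl.
    by apply: cvgM; apply: cvgD;
      [exact: cvg_cst|exact: cn|exact: cvg_cst|exact: cn].
  - by move=> x; rewrite /expabs normrN mulNr.
  - by move=> x x0; rewrite mulr_ge0// divr_ge0 ?expabs_ge0// addr_ge0.
  - by move=> x; exact: is_derive_pos_partX.
  - by move=> x; apply: cvgM; [exact: cvg_cst|exact: continuous_pos_partX].
  - by move=> x; exact: exprn_ge0.
  - exact: measurable_funM.
  - by move=> x; rewrite mulr_ge0// ltW.
  move=> x; rewrite /P /r.
  have [s0|s0] := leP (f x - 2) 0.
    rewrite !expr0n/= !(mulr0, mul0r) !addr0.
    by rewrite mulr_ge0// ltW.
  set s := f x - 2 in s0 *.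
  have fE : f x = s + 2 by rewrite /s subrK.
  have f2 : 2 <= f x by rewrite fE lerDr ltW.
  have -> : \1_[set y | 2 <= f y] x = 1 :> R by rewrite indicE mem_set.
  rewrite mul1r.
  have E0 := expabs_ge0 1 x; set E := expabs 1 x in E0 *.
  have X0 := normr_ge0 x; set X := `|x| in X0 *.
  have X1 : 0 < 1 + X by rewrite ltr_pwDl.
  (* For s > 6 the cubic term suffices, otherwise the term in f^2 does. *)
  have young : 3 * s ^+ 2 <= 2^-1 * s ^+ 3 + 3 * (f x) ^+ 2.
    rewrite fE; have [s6|s6] := leP s 6.
      have : 0 <= s ^+ 3 by rewrite exprn_ge0// ltW.
      nra.
    have : 0 <= s ^+ 2 * (s - 6) by rewrite mulr_ge0 ?sqr_ge0; lra.
    have : 0 <= (s + 2) ^+ 2 by exact: sqr_ge0.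
    lra.
  have cross : x * (E / (1 + X)) * (3 * s ^+ 2 * f' x) <=
      (2^-1 * (X / (1 + X)) * s ^+ 3 + 3 * (f x) ^+ 2) * E.
    rewrite (le_trans (ler_norm _))// !normrM -/X.
    have s20 : 0 <= s * s by rewrite mulr_ge0// ltW.
    rewrite (ger0_norm E0) (gtr0_norm s0) normfV (gtr0_norm X1) normr_nat.
    apply: (@le_trans _ _ (X * (E / (1 + X)) * (3 * (s * s)))).
      rewrite ler_wpM2l//; first by rewrite mulr_ge0// divr_ge0// ltW.
      by rewrite ler_piMr// mulr_ge0.
    rewrite [leLHS](_ : _ = (X / (1 + X)) * (3 * s ^+ 2) * E); last by ring.
    rewrite ler_wpM2r//.
    have Xd0 : 0 <= X / (1 + X) by rewrite divr_ge0// ltW.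
    have Xd1 : X / (1 + X) <= 1 by rewrite ler_pdivrMr// mul1r lerDr.
    have := ler_wpM2l Xd0 young.
    have : X / (1 + X) * (3 * f x ^+ 2) <= 3 * f x ^+ 2.
      by rewrite ler_piMl// mulr_ge0// sqr_ge0.
    lra.
  have s30 : 0 <= s ^+ 3 by rewrite exprn_ge0// ltW.
  set g := (1 - X - X ^+ 2) / (1 + X) ^+ 2.
  have coef : (g + 2^-1 * (X / (1 + X)) + 4^-1) * s ^+ 3 <=
      2 * (5 + T) * f x ^+ 2.
    have gE : g + 2^-1 * (X / (1 + X)) + 4^-1 =
        (5 - X ^+ 2) / (4 * (1 + X) ^+ 2).
      by rewrite /g; field; rewrite gt_eqF.
    (* For X >= 3 the numerator 5 - X^2 is negative. For X < 3 the coefficient is at most 2 and f(x)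
       <= f(y) + |x - y| <= 2 + 3 + T. *)
    have [X3|X3] := leP 3 X.
      apply: (@le_trans _ _ 0); last first.
        by rewrite mulr_ge0 ?sqr_ge0// mulr_ge0//; lra.
      rewrite gE mulr_le0_ge0// mulr_le0_ge0//; last first.
        by rewrite invr_ge0; apply: mulr_ge0 => //; exact: sqr_ge0.
      have : 0 <= (X - 3) * X by rewrite mulr_ge0; lra.
      by move=> ?; lra.
    have c2 : g + 2^-1 * (X / (1 + X)) + 4^-1 <= 2.
      rewrite gE ler_pdivrMr; last by rewrite mulr_gt0// exprn_gt0.
      have : 0 <= X ^+ 2 by exact: sqr_ge0.
      nra.
    have fx : f x <= 5 + T.
      have := lipschitz_derive_le1 x y df f'1.
      have := ler_normB x y; rewrite -/X. lra.
    have s3 : s ^+ 3 <= f x ^+ 2 * (5 + T).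
      rewrite exprSr ler_pM ?sqr_ge0//; first exact: ltW.
        by rewrite fE; nra.
      by rewrite (le_trans _ fx)// fE lerDl.
    apply: (@le_trans _ _ (2 * s ^+ 3)); first by rewrite ler_wpM2r.
    by rewrite -mulrA ler_wpM2l// mulrC.
  rewrite [leRHS](_ : _ = (2 * (5 + T) * f x ^+ 2 + 3 * f x ^+ 2) * E);
    last first.
    by rewrite /C1; ring.
  have := ler_wpM2r E0 coef; rewrite -/g; lra.
apply: (@le_trans _ _ (\int[leb]_x (216%:E * (P x)%:E))%E).
  apply: ge0_le_integral => //.
  - by move=> x _; rewrite lee_fin mulr_ge0 ?level3_entropy_ge0 ?expabs_ge0.
  - apply/measurable_EFinP; apply: measurable_funM;
    last exact: measurable_expabs.
    exact: measurable_level3_entropy.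
  - have mP := continuous_measurable_fun cP.
    by apply/measurable_EFinP; exact: measurable_funM.
  move=> x _; rewrite -EFinM lee_fin.
  rewrite indicE; have [fx3|fx3] := leP 3 (f x); last first.
    rewrite memNset/= ?mul0r//; first by rewrite mulr_ge0.
    by apply/negP; rewrite -ltNge.
  rewrite mem_set// mul1r /P !mulrA ler_wpM2r ?expabs_ge0//.
  have s1 : 1 <= f x - 2 by lra.
  have fx0 : 0 < f x by lra.
  rewrite max_l ?(le_trans _ s1)// lnXn// -(mulr_natr (ln (f x))).
  have lnf := ltW (ln_sublinear fx0).
  apply: (@le_trans _ _ (f x ^+ 2 * (f x * 2))).
    by rewrite ler_wpM2l ?sqr_ge0// ler_wpM2r.
  have : f x ^+ 3 <= (3 * (f x - 2)) ^+ 3.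
    by rewrite lerXn2r ?nnegrE//; lra.
  rewrite exprMn; lra.
have mP := continuous_measurable_fun cP.
rewrite ge0_integralZl//; last 2 first.
- exact/measurable_EFinP.
- by move=> x _; rewrite lee_fin.
rewrite EFinM -muleA lee_wpmul2l ?lee_fin// (le_trans PR)//.
rewrite /r; under eq_integral do rewrite EFinM.
rewrite ge0_integralZl// ?lee_fin ?(ltW C10)//.
- exact/measurable_EFinP.
- by move=> x _; rewrite lee_fin.
Qed.

End entropy_exponential.

(** * Entropy and variance under a unit second moment *)

Section entropy_variance.
Context d (T : measurableType d) (R : realType) (P : probability T R).
Context (f : T -> R) (mf : measurable_fun [set: T] f).
Context (f0 : forall x, 0 <= f x) (f1 : (\int[P]_x (f x ^+ 2)%:E = 1)%E).
Local Open Scope ereal_scope.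

Let mf2 : measurable_fun [set: T] (fun x => f x ^+ 2)%R.
Proof. exact: measurable_funX. Qed.

Let if2 : P.-integrable [set: T] (EFin \o (fun x => f x ^+ 2)%R).
Proof.
apply/integrableP; split; first exact/measurable_EFinP.
under eq_integral do rewrite gee0_abs ?lee_fin ?sqr_ge0//.
by rewrite f1 ltry.
Qed.

Let i1 : P.-integrable [set: T] (EFin \o (cst 1%R : T -> R)).
Proof. exact: finite_measure_integrable_cst. Qed.

Let if_ : P.-integrable [set: T] (EFin \o f).
Proof.
have i2 : P.-integrable [set: T] (EFin \o (fun x => f x ^+ 2 + 1)%R).
  have := integrableD measurableT if2 i1.
  by apply: eq_integrable.
apply: (le_integrable measurableT _ _ i2); first exact/measurable_EFinP.
move=> x _ /=; rewrite lee_fin !ger0_norm ?addr_ge0 ?sqr_ge0//.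
by have := sqr_ge0 (f x - 1); have := f0 x; lra.
Qed.

(** With m the mean of f, the left side is 2 - 2m and the variance is 1 - m^2. Nonnegativity of f
    and of the variance gives 0 <= m <= 1, and the difference of the two sides is 2m (1 - m). *)
Lemma integral_sqrB1_le_variance :
  \int[P]_x ((f x - 1) ^+ 2)%:E <= 2%:E * 'V_P[f].
Proof.
have msq : measurable_fun [set: T] (fun x => (f x - 1) ^+ 2)%R.
  by apply: measurable_funX; apply: measurable_funB => //;
    exact: measurable_cst.
have mfin : \int[P]_x (f x)%:E \is a fin_num by exact: integrable_fin_num if_.
have [m mE] : exists m, \int[P]_x (f x)%:E = m%:E.
  by exists (fine (\int[P]_x (f x)%:E)); rewrite fineK.
have m0 : (0 <= m)%R.
  by rewrite -lee_fin -mE; apply: integral_ge0 => x _; rewrite lee_fin.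
have VE : 'V_P[f] = (1 - m ^+ 2)%:E.
  rewrite /variance covarianceE; last 3 first.
  - exact/Lfun1_integrable.
  - exact/Lfun1_integrable.
  - by apply/Lfun1_integrable.
  rewrite unlock mE.
  by rewrite (eq_integral (fun x => (f x ^+ 2)%:E))// f1 -EFinM -EFinB expr2.
have V0 : (0 <= 1 - m ^+ 2)%R by rewrite -lee_fin -VE variance_ge0.
have m1 : (m <= 1)%R by rewrite -(@expr_le1 _ 2)// -subr_ge0.
have : \int[P]_x ((f x - 1) ^+ 2)%:E + 2%:E * \int[P]_x (f x)%:E = 2%:E.
  rewrite -ge0_integralZl//; last 2 first.
  - exact/measurable_EFinP.
  - by move=> x _; rewrite lee_fin.
  rewrite -ge0_integralD//; last 4 first.
  - by move=> x _; rewrite lee_fin sqr_ge0.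
  - exact/measurable_EFinP.
  - by move=> x _; rewrite -EFinM lee_fin mulr_ge0.
  - by apply/measurable_EFinP; exact: measurable_funM.
  rewrite (eq_integral (fun x => (f x ^+ 2)%:E + 1%:E)); last first.
    by move=> x _; rewrite -EFinM -!EFinD; congr EFin; ring.
  rewrite ge0_integralD//; last 2 first.
  - by move=> x _; rewrite lee_fin sqr_ge0.
  - exact/measurable_EFinP.
  by rewrite f1 integral_cst//= mul1e probability_setT -EFinD.
rewrite mE VE -!EFinM; case: (\int[P]_x _) => [r| |]//.
rewrite -EFinD => -[rm]; rewrite lee_fin.
have : (0 <= m * (1 - m))%R by rewrite mulr_ge0// subr_ge0.
lra.
Qed.

(** Where f >= 2 one has f <= 2 (f - 1), hence f^2 <= 4 (f - 1)^2. *)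
Lemma integral_level2_le_variance :
  \int[P]_x (\1_[set y | (2 <= f y)%R] x * f x ^+ 2)%:E <= 8%:E * 'V_P[f].
Proof.
have msq : measurable_fun [set: T] (fun x => (f x - 1) ^+ 2)%R.
  by apply: measurable_funX; apply: measurable_funB => //;
    exact: measurable_cst.
have -> : 8%:E * 'V_P[f] = 4%:E * (2%:E * 'V_P[f]).
  by rewrite muleA -EFinM; congr (_%:E * _); ring.
apply: (@le_trans _ _ (4%:E * \int[P]_x ((f x - 1) ^+ 2)%:E)); last first.
  by rewrite lee_wpmul2l// integral_sqrB1_le_variance.
rewrite -ge0_integralZl//; last 2 first.
- exact/measurable_EFinP.
- by move=> x _; rewrite lee_fin sqr_ge0.
apply: ge0_le_integral => //.
- by move=> x _; rewrite lee_fin mulr_ge0 ?sqr_ge0.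
- apply/measurable_EFinP; apply: measurable_funM => //.
  exact: (measurable_indic (measurable_level _ mf)).
- by apply/measurable_EFinP; exact: measurable_funM.
- move=> x _; rewrite -EFinM lee_fin indicE.
  have [fx|fx] := leP 2%R (f x); last first.
    rewrite memNset/=; last by apply/negP; rewrite -ltNge.
    by rewrite mul0r mulr_ge0 ?sqr_ge0.
  rewrite mem_set// mul1r.
  have : (0 <= (f x - 2) * (3 * f x - 2))%R by rewrite mulr_ge0; lra.
  lra.
Qed.

(** Subtracting f^2 - 1, whose integral is 0, leaves a function bounded by 16 (f - 1)^2 below level
    3 and by the entropy integrand above it. The 32 is 16 times the 2 of
    [integral_sqrB1_le_variance]. *)
Lemma Ent_le_variance :
  Ent P (fun x => f x ^+ 2)%R <= 32%:E * 'V_P[f] +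
  \int[P]_x (\1_[set y | (3 <= f y)%R] x * (f x ^+ 2 * ln (f x ^+ 2)))%:E.
Proof.
pose g x := (f x ^+ 2 * ln (f x ^+ 2))%R.
have mg : measurable_fun [set: T] g.
  apply: measurable_funM => //.
  exact: (measurableT_comp (@measurable_ln R)).
pose u x := (\1_[set y | (3 <= f y)%R] x * g x)%R.
pose Q x := (16 * (f x - 1) ^+ 2 + u x)%R.
have u0 x : (0 <= u x)%R by exact: level3_entropy_ge0.
have mu : measurable_fun [set: T] u by exact: measurable_level3_entropy.
have msq : measurable_fun [set: T] (fun x => (f x - 1) ^+ 2)%R.
  by apply: measurable_funX; apply: measurable_funB => //;
    exact: measurable_cst.
have Q0 x : (0 <= Q x)%R by rewrite addr_ge0// mulr_ge0 ?sqr_ge0.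
have mQ : measurable_fun [set: T] Q.
  by apply: measurable_funD => //; exact: measurable_funM.
(* Both bounds come from ln v <= v - 1, the lower one applied to 1 / f^2. The lower bound helps to
   make [g] integrable; the upper one carries the estimate. *)
have gQ x : (f x ^+ 2 - 1 <= g x <= (f x ^+ 2 - 1) + Q x)%R.
  rewrite /g; have [fx0|fx0] := eqVneq (f x) 0%R.
    rewrite fx0 expr0n/= !mul0r sub0r lerN10/=.
    have := u0 x; rewrite /Q fx0; lra.
  have v0 : (0 < f x ^+ 2)%R by rewrite exprn_gt0// lt0r fx0 f0.
  have lnle (v : R) : (0 < v)%R -> (ln v <= v - 1)%R.
    move=> v_gt0; have := @le_ln1Dx R (v - 1).
    by rewrite subrKC; apply; rewrite ltrBrDr addNr.
  apply/andP; split.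
    have := lnle _ (eqbRL (invr_gt0 _) v0).
    rewrite lnV ?posrE// => h.
    have := ler_wpM2l (ltW v0) h.
    by rewrite mulrBr divff ?gt_eqF// mulr1 mulrN; lra.
  have [fx3|fx3] := leP 3%R (f x).
    rewrite /Q /u indicE mem_set// mul1r -/(g x).
    have : (0 <= (f x - 1) ^+ 2)%R by exact: sqr_ge0.
    have : (0 <= (f x - 3) * (f x + 3))%R by rewrite mulr_ge0; lra.
    by rewrite /g; lra.
  have h := ler_wpM2l (ltW v0) (lnle _ v0).
  rewrite (le_trans h)// (@le_trans _ _ (f x ^+ 2 - 1 +
    16 * (f x - 1) ^+ 2)%R)//.
    (* The excess over f^2 - 1 is (f^2 - 1)^2 = (f - 1)^2 (f + 1)^2, and 16 - (f + 1)^2 = (3 - f)(f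
       + 5). *)
    have : (0 <= (f x - 1) ^+ 2 * ((3 - f x) * (f x + 5)))%R.
      by rewrite mulr_ge0 ?sqr_ge0// mulr_ge0; have := f0 x; lra.
    lra.
  by rewrite /Q addrA lerDl.
have QE : \int[P]_x (Q x)%:E = 16%:E * \int[P]_x ((f x - 1) ^+ 2)%:E +
     \int[P]_x (u x)%:E.
  under eq_integral do rewrite EFinD EFinM.
  rewrite ge0_integralD//.
  - rewrite ge0_integralZl//; first exact/measurable_EFinP.
    by move=> x _; rewrite lee_fin sqr_ge0.
  - by move=> x _; rewrite -EFinM lee_fin mulr_ge0 ?sqr_ge0.
  - by apply/measurable_EFinP; exact: measurable_funM.
  - by move=> x _; rewrite lee_fin.
  - exact/measurable_EFinP.
apply: (@le_trans _ _ (\int[P]_x (Q x)%:E)); last first.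
  rewrite QE leeD2r// (_ : 32%:E = 16%:E * 2%:E)%E; last first.
    by rewrite -EFinM; congr EFin; ring.
  by rewrite -muleA lee_wpmul2l// integral_sqrB1_le_variance.
have -> : Ent P (fun x => f x ^+ 2)%R = \int[P]_x (g x)%:E.
  by rewrite /Ent f1/=; apply: eq_integral => x _; rewrite divr1.
have [Qy|Qfin] := eqVneq (\int[P]_x (Q x)%:E) +oo; first by rewrite Qy leey.
have iQ : P.-integrable [set: T] (EFin \o Q).
  apply/integrableP; split; first exact/measurable_EFinP.
  under eq_integral do rewrite gee0_abs ?lee_fin//.
  by rewrite ltey.
have iv : P.-integrable [set: T] (EFin \o (fun x => f x ^+ 2 - 1)%R).
  have := integrableB measurableT if2 i1.
  by apply: eq_integrable.
have ivQ : P.-integrable [set: T] (EFin \o (fun x => (f x ^+ 2 - 1) + Q x)%R).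
  have := integrableD measurableT iv iQ.
  by apply: eq_integrable.
have ig : P.-integrable [set: T] (EFin \o g).
  have := integrableD measurableT (integrable_abse iv) iQ.
  apply: le_integrable => //; first exact/measurable_EFinP.
  move=> x _ /=; rewrite lee_fin.
  have /andP[h1 h2] := gQ x.
  apply: le_trans (ler_norm _); rewrite ler_norml; apply/andP; split.
  - by have := ler_norm (- (f x ^+ 2 - 1))%R; rewrite normrN; have := Q0 x; lra.
  - by have := ler_norm (f x ^+ 2 - 1)%R; lra.
apply: (@le_trans _ _ (\int[P]_x ((f x ^+ 2 - 1) + Q x)%:E)).
  by apply: le_integral => // x _; rewrite lee_fin; have /andP[] := gQ x.
under eq_integral do rewrite EFinD.
rewrite (integralD_EFin measurableT iv iQ)/=.
under [X in X + _]eq_integral do rewrite EFinB.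
rewrite (integralB_EFin measurableT if2 i1)/= f1 integral_cst//= mul1e.
by rewrite probability_setT subee// add0e.
Qed.

End entropy_variance.

(** * A point below level 2 in a fixed interval *)

Section tightness.
Context {R : realType}.

Lemma probability_itv_gt (P : probability R R) (c : R) : c < 1 ->
  exists n : nat, (c%:E < P [set` `[(- n%:R)%R, n%:R%R]])%E.
Proof.
move=> c1.
pose D n : set R := [set` `[(- n%:R)%R, n%:R%R]].
have DT : \bigcup_n D n = [set: R].
  apply/seteqP; split => // x _; exists (Num.truncn `|x|).+1 => //=.
  by rewrite /D/= in_itv/= -ler_norml ltW// truncnS_gt.
have ndD : nondecreasing_seq D.
  move=> m n mn; apply/subsetPset => x; rewrite /D/= !in_itv/= -!ler_norml.
  by move/le_trans; apply; rewrite ler_nat.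
have mD n : measurable (D n) by exact: measurable_itv.
have := @nondecreasing_cvg_mu _ _ _ P D mD.
rewrite DT => /(_ measurableT ndD) cvg1.
apply: contrapT => /forallNP h.
have : (1 <= c%:E)%E.
  rewrite -(probability_setT P).
  apply: (cvge_to_le cvg1); apply: nearW => n /=.
  by rewrite leNgt; apply/negP; exact: h.
by rewrite lee_fin leNgt c1.
Qed.

(** Otherwise f^2 >= 4 on a set of mass above 1/4, and its integral would exceed 1. The interval
    depends on the measure alone, which keeps the later constants independent of f. *)
Lemma exists_lt2 (P : probability R R) (f : R -> R) (n : nat) :
  measurable_fun [set: R] f -> (\int[P]_x (f x ^+ 2)%:E = 1)%E ->
  ((4^-1)%:E < P [set` `[(- n%:R)%R, n%:R%R]])%E ->
  exists2 y : R, `|y| <= n%:R & f y < 2.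
Proof.
move=> mf f1 Pn; apply: contrapT => /forall2NP h.
have : (\int[P]_(x in [set` `[(- n%:R)%R, n%:R%R]]) 4%:E <= 1)%E.
  rewrite -f1; apply: (@le_trans _ _
      (\int[P]_(x in [set` `[(- n%:R)%R, n%:R%R]]) (f x ^+ 2)%:E)%E).
    apply: ge0_le_integral => //.
    - by apply/measurable_EFinP/measurable_funTS; exact: measurable_funX.
    - move=> x /=; rewrite in_itv/= -ler_norml => xn.
      rewrite lee_fin; have [//|/negP] := h x.
      rewrite -leNgt => fx2.
      rewrite (_ : 4 = 2 ^+ 2) ?lerXn2r ?nnegrE//; last by ring.
      exact: le_trans fx2.
  apply: ge0_subset_integral => //.
  - by apply/measurable_EFinP; exact: measurable_funX.
  - by move=> x _; rewrite lee_fin sqr_ge0.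
rewrite integral_cst// leNgt => /negP; apply.
by rewrite -lte_pdivrMl// mule1.
Qed.

End tightness.

(** * Passage to [mu_alpha] and conclusion *)

Section assembly.
Context {R : realType}.
Local Notation leb := (@lebesgue_measure R).

Lemma C1_is_derive (f : R -> R) : C1 f ->
  forall x : R, is_derive x 1 f (f^`()%classic x).
Proof. by move=> [df _] x; apply: DeriveDef; rewrite ?derive1E. Qed.

Lemma Cinfty_C1 (f : R -> R) : Cinfty f -> C1 f.
Proof.
move=> sf; split; first exact: sf 0%N.
move=> x; apply: differentiable_continuous; apply/derivable1_diffP.
exact: sf 1%N x.
Qed.

Lemma ler_integral_mu_alpha (a : R) (a1 : 1 <= a) (g h : R -> R) (C : R) :
  measurable_fun [set: R] g -> (forall x, 0 <= g x) ->
  measurable_fun [set: R] h -> (forall x, 0 <= h x) ->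
  (\int[leb]_x (g x * expabs a x)%:E <=
   C%:E * \int[leb]_x (h x * expabs a x)%:E)%E ->
  (\int[mu_alpha a1]_x (g x)%:E <= C%:E * \int[mu_alpha a1]_x (h x)%:E)%E.
Proof.
move=> mg g0 mh h0 le; rewrite !ge0_integral_mu_alpha// muleCA.
by rewrite lee_wpmul2l// lee_fin invr_ge0 ltW// Zalpha_gt0.
Qed.

Lemma integral_sqr_expabs (a : R) (a1 : 1 <= a) (f : R -> R) :
  measurable_fun [set: R] f -> (\int[mu_alpha a1]_x (f x ^+ 2)%:E = 1)%E ->
  (\int[leb]_x (f x ^+ 2 * expabs a x)%:E = (Zalpha a)%:E)%E.
Proof.
move=> mf; rewrite ge0_integral_mu_alpha//; last 2 first.
- exact: measurable_funX.
- by move=> x; exact: sqr_ge0.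
have Z0 := Zalpha_gt0 a1.
have I0 : (0 <= \int[leb]_x (f x ^+ 2 * expabs a x)%:E)%E.
  apply: integral_ge0 => x _.
  by rewrite lee_fin mulr_ge0 ?sqr_ge0 ?expabs_ge0.
case: (\int[leb]_x _)%E I0 => [r _| |]//.
  rewrite -EFinM => -[] ZrE; congr EFin.
  by rewrite -[LHS](mulVKf (lt0r_neq0 Z0)) ZrE mulr1.
by move=> _; rewrite gt0_muley// lte_fin invr_gt0.
Qed.

End assembly.

Theorem theorem3p1 (R : realType) :
  (forall (a b : R) (a1 : 1 < a), a <= 2 -> a^-1 + b^-1 = 1 ->
    exists A B : R, [/\ 0 < A, 0 < B &
      forall f : R -> R, Cinfty f -> (forall x, 0 <= f x) ->
        (\int[mu_alpha (ltW a1)]_x (f x ^+ 2)%:E = 1)%E ->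
        (Ent (mu_alpha (ltW a1)) (fun x => f x ^+ 2)%R
         <= A%:E * 'V_(mu_alpha (ltW a1))[f]
            + B%:E * \int[mu_alpha (ltW a1)]_(x in [set x | (2 <= f x)%R])
                (`|(f^`())%classic x / f x| `^ b * f x ^+ 2)%:E)%E])
  /\
  (exists A : R, 0 < A /\
    forall f : R -> R, C1 f -> (forall x, 0 <= f x) ->
      (\int[mu_alpha (lexx (1%R : R))]_x (f x ^+ 2)%:E = 1)%E ->
      (forall x, `|(f^`())%classic x| <= 1) ->
      (Ent (mu_alpha (lexx (1%R : R))) (fun x => f x ^+ 2)%R
       <= A%:E * 'V_(mu_alpha (lexx (1%R : R)))[f])%E).
Proof.
have q1 : 4^-1 < 1 :> R by rewrite invf_lt1// ltr1n.
split.
  move=> a b a1 _ ab.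
  pose mu := mu_alpha (ltW a1).
  have [n Pn] := probability_itv_gt mu q1.
  have [C C0 core] := upper_entropy_le_energy n%:R a1 ab.
  (* The 32 is from [Ent_le_variance]; the f^2 part of the energy adds [C * 8] through
     [integral_level2_le_variance], and its gradient part gives the second constant. *)
  exists (32 + C * 8), C; split => //.
    by rewrite addr_gt0// mulr_gt0.
  move=> f /Cinfty_C1 fC1 f0 f1.
  have df := C1_is_derive fC1; have [_ cf'] := fC1.
  have cf := is_derive1_continuous df.
  have mf : measurable_fun [set: R] f := continuous_measurable_fun cf.
  have mf' : measurable_fun [set: R] (f^`()%classic) :=
    continuous_measurable_fun cf'.
  have fy := exists_lt2 mf f1 Pn.
  have up := core f _ df cf' f0 (integral_sqr_expabs mf f1) fy.
  pose I2 x : R := \1_[set y | 2 <= f y] x.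
  pose J x : R := I2 x * (`|f^`()%classic x / f x| `^ b * f x ^+ 2).
  have mI2 : measurable_fun [set: R] I2.
    exact: (measurable_indic (measurable_level _ mf)).
  have mI2f : measurable_fun [set: R] (fun x => I2 x * f x ^+ 2).
    by apply: measurable_funM => //; exact: measurable_funX.
  have mJ : measurable_fun [set: R] J.
    apply: measurable_funM => //.
    apply: measurable_funM; last exact: measurable_funX.
    apply: (measurableT_comp (measurable_powR b)).
    apply: (measurableT_comp (@normr_measurable R setT)).
    exact: measurable_fun_divr.
  have I2f0 x : 0 <= I2 x * f x ^+ 2 by apply: mulr_ge0 => //; exact: sqr_ge0.
  have J0 x : 0 <= J x.
    by apply: mulr_ge0 => //; apply: mulr_ge0; [exact: powR_ge0|exact: sqr_ge0].
  have JE : (\int[mu]_(x in [set x | (2 <= f x)%R])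
      (`|(f^`())%classic x / f x| `^ b * f x ^+ 2)%:E = \int[mu]_x (J x)%:E)%E.
    rewrite integral_mkcond; apply: eq_integral => x _.
    rewrite patchE /J /I2 indicE.
    by case: ifPn => _; rewrite ?mul1r ?mul0r.
  have upmu : (\int[mu]_x (\1_[set y | (3 <= f y)%R] x *
      (f x ^+ 2 * ln (f x ^+ 2)))%:E <=
      C%:E * \int[mu]_x (I2 x * f x ^+ 2 + J x)%:E)%E.
    apply: ler_integral_mu_alpha => //.
    - exact: measurable_level3_entropy.
    - by move=> x; exact: level3_entropy_ge0.
    - exact: measurable_funD.
    - by move=> x; rewrite addr_ge0.
    apply: (le_trans up); rewrite le_eqVlt; apply/orP; left; apply/eqP.
    congr (_ * _)%E; apply: eq_integral => x _; congr EFin.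
    by rewrite /energy /J /I2; ring.
  have Ent_le := Ent_le_variance mf f0 f1.
  have lev := integral_level2_le_variance mf f0 f1.
  rewrite JE; apply: (le_trans Ent_le).
  have V0 : (0 <= 'V_mu[f])%E by exact: variance_ge0.
  rewrite (EFinD 32) (EFinM C) ge0_muleDl//;
    last by rewrite mule_ge0// lee_fin ltW.
  rewrite -addeA leeD2l//.
  apply: (le_trans upmu).
  under eq_integral do rewrite EFinD.
  rewrite ge0_integralD//; last 4 first.
  - by move=> x _; rewrite lee_fin.
  - exact/measurable_EFinP.
  - by move=> x _; rewrite lee_fin.
  - exact/measurable_EFinP.
  rewrite ge0_muleDr//; last 2 first.
  - by apply: integral_ge0 => x _; rewrite lee_fin.
  - by apply: integral_ge0 => x _; rewrite lee_fin.
  rewrite leeD2r// -muleA lee_wpmul2l ?lee_fin ?(ltW C0)//.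
pose mu := mu_alpha (lexx (1 : R)).
have [n Pn] := probability_itv_gt mu q1.
have [C C0 core] := upper_entropy_le_exponential (ler0n R n).
(* As before, but the derivative bound has already removed the gradient term. *)
exists (32 + C * 8); split.
  by rewrite addr_gt0// mulr_gt0.
move=> f fC1 f0 f1 f'1.
have df := C1_is_derive fC1; have [_ cf'] := fC1.
have cf := is_derive1_continuous df.
have mf : measurable_fun [set: R] f := continuous_measurable_fun cf.
have fy := exists_lt2 mf f1 Pn.
have up := core f _ df cf' f0 f'1 fy.
have upmu : (\int[mu]_x (\1_[set y | (3 <= f y)%R] x *
    (f x ^+ 2 * ln (f x ^+ 2)))%:E <=
    C%:E * \int[mu]_x (\1_[set y | (2 <= f y)%R] x * f x ^+ 2)%:E)%E.
  apply: ler_integral_mu_alpha => //.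
  - exact: measurable_level3_entropy.
  - by move=> x; exact: level3_entropy_ge0.
  - apply: measurable_funM; last exact: measurable_funX.
    exact: (measurable_indic (measurable_level _ mf)).
  - by move=> x; apply: mulr_ge0 => //; exact: sqr_ge0.
apply: (le_trans (Ent_le_variance mf f0 f1)).
have V0 : (0 <= 'V_mu[f])%E by exact: variance_ge0.
rewrite (EFinD 32) (EFinM C) ge0_muleDl//;
  last by rewrite mule_ge0// lee_fin ltW.
rewrite leeD2l//.
apply: (le_trans upmu).
rewrite -muleA lee_wpmul2l ?lee_fin ?(ltW C0)//.
exact: integral_level2_le_variance.
Qed.
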